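(* Let $q$ be a prime power and let $\mathcal{F}\subset\mathbb{F}_q[x,y,z]$ be the set of non-constant homogeneous polynomials $f$ such that $C=\{f=0\}$ is a smooth transverse-free plane curve. Then \[ \overline{\mu}(\mathcal{F})\le(1-q^{-2})^{-(q^2+q+1)}\left(\frac1q+\frac1{q^2}-\frac1{q^3}\right)^{q^2+q+1}. \]
   Context: Let $R=\mathbb{F}_q[x,y,z]$, $R_d$ the homogeneous polynomials of degree $d$ (including $0$), $\mu_d(\mathcal{A})=\#(\mathcal{A}\cap R_d)/\#R_d$, and the upper density $\overline{\mu}(\mathcal{A})=\limsup_{d\to\infty}\mu_d(\mathcal{A})$. A plane curve of degree $d$ over $\mathbb{F}_q$ is transverse-free if no line defined over $\mathbb{F}_q$ meets it in $d$ distinct points over $\overline{\mathbb{F}}_q$; for a smooth curve this means every $\mathbb{F}_q$-line is tangent to it. *)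

(* Defs.v *)
From HB Require Import structures.
From mathcomp Require Import all_boot all_order all_algebra all_field.
From mathcomp Require Import boolp.
From mathcomp Require Import mpoly.

Set Implicit Arguments.
Unset Strict Implicit.
Unset Printing Implicit Defensive.

Import GRing.Theory.
Local Open Scope ring_scope.

Section PlaneCurves.
Variable F : finFieldType.

Definition Fbar : closedFieldType := projT1 (countable_algebraic_closure F).
Definition iota : {rmorphism F -> Fbar} :=
  sval (projT2 (countable_algebraic_closure F)).

Definition pt_nz (v : 'I_3 -> Fbar) : Prop := exists i, v i != 0.
Definition proportional (u v : 'I_3 -> Fbar) : Prop :=
  exists2 c : Fbar, c != 0 & forall i, u i = c * v i.

Definition on_curve (f : {mpoly F[3]}) (v : 'I_3 -> Fbar) : Prop :=
  (map_mpoly iota f).@[v] = 0.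

Definition singular_point (f : {mpoly F[3]}) (v : 'I_3 -> Fbar) : Prop :=
  [/\ pt_nz v, on_curve f v & forall i : 'I_3, (map_mpoly iota (f^`M(i))).@[v] = 0].

Definition smooth_curve (f : {mpoly F[3]}) : Prop :=
  ~ exists v, singular_point f v.

Definition is_line (a : 'I_3 -> F) : Prop := exists i, a i != 0.
Definition on_line (a : 'I_3 -> F) (v : 'I_3 -> Fbar) : Prop :=
  \sum_(i < 3) iota (a i) * v i = 0.

Definition meets_in_distinct (f : {mpoly F[3]}) (d : nat) (a : 'I_3 -> F) : Prop :=
  exists P : 'I_d -> ('I_3 -> Fbar),
    [/\ (forall k, [/\ pt_nz (P k), on_line a (P k) & on_curve f (P k)]),
        (forall k l, k != l -> ~ proportional (P k) (P l)) &
        (forall v, pt_nz v -> on_line a v -> on_curve f v ->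
           exists k, proportional v (P k))].

Definition transverse_free (f : {mpoly F[3]}) (d : nat) : Prop :=
  forall a : 'I_3 -> F, is_line a -> ~ meets_in_distinct f d a.

Definition in_calF (f : {mpoly F[3]}) (d : nat) : Prop :=
  [/\ f \is d.-homog, f != 0, (0 < d)%N, smooth_curve f & transverse_free f d].

(* R_d: homogeneous polynomials of degree d (including 0), parametrized
   bijectively by their coefficient vectors on the monomials of degree d. *)
Definition hmon (d : nat) := {m : 'X_{1..3 < d.+1} | mdeg m == d}.
Definition poly_of (d : nat) (c : {ffun hmon d -> F}) : {mpoly F[3]} :=
  \sum_(m : hmon d) c m *: 'X_[bmnm (val m)].

Definition mu (d : nat) : rat :=
  (#|[set c : {ffun hmon d -> F} | `[< in_calF (poly_of c) d >] ]|%:R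
   / #|{ffun hmon d -> F}|%:R).

End PlaneCurves.

(* Main.v *)
(* A smooth curve f = 0 of degree d > 1 is transverse-free when, on every rational
   line L, the binary form f|L has a repeated factor.  Such a factor is either
   rational, i.e. L is tangent to the curve at a rational point P, or of degree at
   least 2.  Replace f by f + sum_P K_P l_P + sum_L M_L h_L, where K_P vanishes
   doubly at all rational points but P, M_L is the product of the squares of the
   equations of the lines other than L, l_P is a random linear form and h_L a
   random binary form.  If f is uniform then so is the new polynomial, and for each
   fixed f the l_P make the first-order jets at the rational points independent,
   whereas the h_L put the restrictions to the lines into independent random
   arithmetic progressions without affecting these jets.
   - A progression avoids squares of irreducible polynomials of degree >= 2 with
     limiting probability at least s = (1 - 1/q)(1 - 1/q^2)^(-q).
   - Let p = 1/q^2.  At each of the N rational points, the distribution of the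
     tangent line (one of q+1 lines, or none) is at most 1/(1-p) times that of a
     family of q+1 independent events of probability p, because
     1 - 1/q <= (1-p)^q.
   Hence the density is at most (1-p)^(-N) (1 - s (1-p)^(q+1))^N, and
   1 - s (1-p)^(q+1) = 1/q + 1/q^2 - 1/q^3. *)
From mathcomp Require Import all_boot all_order all_algebra all_field.
From mathcomp Require Import boolp ring lra zify.
From mathcomp Require mpoly.
Require Import Defs.

Set Implicit Arguments.
Unset Strict Implicit.
Unset Printing Implicit Defensive.
Import Order.TTheory GRing.Theory Num.Theory.
Local Open Scope ring_scope.

(** * Squares in arithmetic progressions of polynomials *)

Lemma card_cover (T I : finType) (P : pred I) (A : {set T}) (B : I -> {set T}) :
  (forall x, x \in A -> exists2 i, P i & x \in B i) -> (#|A| <= \sum_(i | P i) #|B i|)%N.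
Proof.
move=> cov; apply: (@leq_trans #|\bigcup_(i | P i) B i|).
  by apply/subset_leq_card/subsetP => x /cov [i Pi xB]; apply/bigcupP; exists i.
elim/big_rec2: _ => [|i n C Pi le_n]; first by rewrite cards0.
by apply: leq_trans (leq_card_setU _ _) _; rewrite leq_add2l.
Qed.

(** The sum telescopes to x^j - x^max(j,k), which is 0 when the range is empty. *)
Lemma geometric_tail (R : numFieldType) (x : R) j k :
  0 <= x -> (1 - x) * \sum_(e < k | (j <= e)%N) x ^+ e <= x ^+ j.
Proof.
move=> x0; suff -> : (1 - x) * \sum_(e < k | (j <= e)%N) x ^+ e = x ^+ j - x ^+ maxn j k.
  by rewrite lerBlDr lerDl exprn_ge0.
elim: k => [|k IH]; first by rewrite big_ord0 mulr0 maxn0 subrr.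
rewrite big_mkcond big_ord_recr /= -big_mkcond mulrDr IH.
case: ifPn => [le_jk|lt_kj].
  have -> : maxn j k.+1 = k.+1 by lia.
  have -> : maxn j k = k by lia.
  rewrite exprS; ring.
have -> : maxn j k.+1 = j by lia.
have -> : maxn j k = j by lia.
ring.
Qed.

(** This lets j tend to infinity in an archimedean field: if a > b, any j > c / (a - b) gives c x^j
    <= c 2^-j < a - b, because 2^j >= j. *)
Lemma le_of_geometric (R : archiRealFieldType) (a b c x : R) :
  0 <= x -> x <= 2^-1 -> 0 <= c -> (forall j, a <= b + c * x ^+ j) -> a <= b.
Proof.
move=> x0 x2 c0 H; rewrite leNgt; apply/negP => lt_ba.
have d0 : 0 < a - b by rewrite subr_gt0.
have cd0 : 0 <= c / (a - b) by rewrite divr_ge0 // ltW.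
have := archi_boundP cd0; set j := Num.bound _.
rewrite ltr_pdivrMr // => lt_j.
have p2 : (j%:R : R) <= 2 ^+ j by rewrite -natrX ler_nat ltnW // ltn_expl.
have := H j; have xj : x ^+ j <= 2^-1 ^+ j by rewrite lerXn2r // nnegrE invr_ge0.
have : 2^-1 ^+ j * 2 ^+ j = 1 :> R by rewrite -exprMn mulVf ?expr1n // pnatr_eq0.
have := exprn_ge0 j x0.
have y0 : 0 < 2^-1 ^+ j :> R by rewrite exprn_gt0 // invr_gt0.
move: (x ^+ j) (2^-1 ^+ j) (2 ^+ j) (j%:R : R) xj p2 lt_j y0 => xj y z n le_xy le_nz lt_c y0 _ yz le_ab.
have h1 : c * y < n * (a - b) * y by rewrite ltr_pM2r.
have h2 : n * (a - b) * y <= z * (a - b) * y by rewrite ler_pM2r // ler_pM2r.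
have h3 : z * (a - b) * y = a - b by rewrite mulrAC [z * y]mulrC yz mul1r.
have h4 : c * xj <= c * y by rewrite ler_wpM2l.
lra.
Qed.

Section Sieve.
Variable F : finFieldType.
Local Notation q := #|F|.
Implicit Types (u A B g m : {poly F}) (s : seq {poly F}).

Lemma size_rVpoly k (v : 'rV[F]_k) : (size (rVpoly v) <= k)%N.
Proof. exact: size_poly. Qed.

Lemma card_rV k : #|{: 'rV[F]_k}| = (q ^ k)%N.
Proof. by rewrite card_mx mul1n. Qed.

Definition sqavoid s A := all (fun u => ~~ (u ^+ 2 %| A)) s.

(** Row vectors of length k, read through [rVpoly], are a finite type of the polynomials of degree
    less than k. *)
Definition apcount k s A B := #|[set v : 'rV[F]_k | sqavoid s (A + B * rVpoly v)]|.

(* The solutions h of u | A + B h are h0 + u w, so that conditioning on this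
   divisibility yields another progression, with B replaced by B u. *)
Lemma progression_dvd k u A B : (0 < size u)%N -> ((size u).-1 <= k)%N -> coprimep u B ->
  exists2 h0 : {poly F}, (u %| A + B * h0) &
   forall P : pred {poly F},
   #|[set v : 'rV[F]_k | (u %| A + B * rVpoly v) && P (A + B * rVpoly v)]|
   = #|[set w : 'rV[F]_(k - (size u).-1) | P ((A + B * h0) + (B * u) * rVpoly w)]|.
Proof.
move=> u0 le_u /Bezout_eq1_coprimepP [[a b] /= ab1].
have unz : u != 0 by rewrite -size_poly_gt0.
(* The Bezout relation makes b an inverse of B modulo u, so h0 is the residue of -A/B. *)
pose h0 := (- A * b) %% u.
have size_h0 : (size h0 <= (size u).-1)%N by rewrite -ltnS prednK // ltn_modp.
have dvd0 : u %| A + B * h0.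
  have -> : A + B * h0 = u * (A * a - B * ((- A * b) %/ u)).
    have e : h0 = - A * b - (- A * b) %/ u * u by apply/eqP; rewrite eq_sym subr_eq addrC -divp_eq.
    rewrite e -[X in X + _](mulr1 A) -ab1; ring.
  exact: dvdp_mulr.
exists h0 => // P.
pose f (w : 'rV[F]_(k - (size u).-1)) : 'rV[F]_k := poly_rV (h0 + u * rVpoly w).
have fE w : rVpoly (f w) = h0 + u * rVpoly w.
  apply: poly_rV_K; apply: leq_trans (size_polyD _ _) _; rewrite geq_max.
  rewrite (leq_trans size_h0 le_u) /=; apply: leq_trans (size_polyMleq _ _) _.
  have aux (x y n : nat) : (0 < y -> y.-1 <= n -> x <= n - y.-1 -> (y + x).-1 <= n)%N by lia.
  exact: aux (size_rVpoly w).
have finj : injective f.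
  move=> w w' /(congr1 rVpoly); rewrite !fE => /addrI/(mulfI unz) e.
  by rewrite -[w]rVpolyK e rVpolyK.
rewrite -(card_imset _ finj); congr #|pred_of_set _|; apply/setP => v.
rewrite !inE; apply/andP/imsetP => [[dv Pv]|[w]]; last first.
  rewrite inE => Pw ->; rewrite fE; split; last by rewrite mulrDr addrA mulrA.
  by rewrite mulrDr addrA dvdp_addr // mulrCA dvdp_mulr.
have dvB : u %| B * (rVpoly v - h0).
  have -> : B * (rVpoly v - h0) = (A + B * rVpoly v) - (A + B * h0) by ring.
  exact: dvdp_sub.
have dvh : u %| rVpoly v - h0.
  by move: dvB; rewrite Gauss_dvdpr //; apply/Bezout_eq1_coprimepP; exists (a, b).
have sz : (size ((rVpoly v - h0) %/ u)%R <= k - (size u).-1)%N.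
  rewrite size_divp // leq_sub2r //; apply: leq_trans (size_polyD _ _) _.
  by rewrite geq_max size_rVpoly size_polyN (leq_trans size_h0).
exists (poly_rV ((rVpoly v - h0) %/ u)).
  by rewrite inE poly_rV_K // -mulrA [u * _]mulrC divpK // mulrBr addrA addrAC addrK.
apply: (can_inj rVpolyK); rewrite fE poly_rV_K // mulrC divpK //.
by rewrite addrC subrK.
Qed.

(** The sieve is exact because k is at least the total degree of the squares. The values that avoid
    the tail of s but are divisible by u^2 form a progression of step B u^2, with k - 2 deg u
    coefficients; its step is still coprime to the tail, so induction applies. *)
Lemma apcountE (R : numFieldType) k s A B :
  (forall u, u \in s -> (1 < size u)%N) -> pairwise (@coprimep _) s ->
  {in s, forall u, coprimep u B} ->
  (\sum_(u <- s) (2 * (size u).-1) <= k)%N ->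
  (apcount k s A B)%:R = q%:R ^+ k * \prod_(u <- s) (1 - q%:R ^- (2 * (size u).-1)) :> R.
Proof.
have q0 : (q%:R : R) != 0 by rewrite pnatr_eq0 -lt0n (ltn_trans _ (finNzRing_gt1 F)).
elim: s k A B => [|u s IH] k A B us pw cop.
  rewrite !big_nil mulr1 => _; rewrite -natrX -card_rV; congr (_%:R).
  by rewrite -cardsT /apcount; apply: eq_card => v; rewrite !inE.
rewrite !big_cons => le_k.
move: pw => /= /andP [/allP pu ps].
have su : (1 < size u)%N by apply: us; rewrite mem_head.
have unz : u != 0 by rewrite -size_poly_gt0 (ltn_trans _ su).
have s2 : size (u ^+ 2) = (2 * (size u).-1).+1.
  by rewrite mulnC -size_exp prednK // size_poly_gt0 expf_neq0.
have [|||h0 dv0 cnt] := @progression_dvd k (u ^+ 2) A B.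
- by rewrite s2.
- by rewrite s2 /= (leq_trans (leq_addr _ _) le_k).
- by apply/coprimep_expl/cop/mem_head.
have /(congr1 (fun n : nat => n%:R : R)) :
    (apcount k (u :: s) A B + apcount (k - 2 * (size u).-1) s (A + B * h0) (B * u ^+ 2))%N
    = apcount k s A B.
  rewrite /apcount -[X in (_ - X)%N]/((2 * (size u).-1).+1.-1) -s2.
  rewrite -(cnt (sqavoid s)).
  rewrite -(cardsID [set v : 'rV[F]_k | u ^+ 2 %| A + B * rVpoly v] [set v : 'rV_k | sqavoid s _]) addnC.
  by congr (_ + _)%N; apply: eq_card => v; rewrite !inE /= andbC //.
have us' x : x \in s -> (1 < size x)%N by move=> xs; apply: us; rewrite inE xs orbT.
rewrite natrD (IH k) //; last 2 first.
- by move=> x xs; apply: cop; rewrite inE xs orbT.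
- exact: leq_trans (leq_addl _ _) le_k.
rewrite IH //; last 2 first.
- move=> x xs; rewrite coprimepMr cop ?inE ?xs ?orbT //= coprimep_expr // coprimep_sym.
  exact: pu.
- by rewrite leq_subRL // (leq_trans (leq_addr _ _) le_k).
move/(canRL (addrK _)) => ->.
have -> : q%:R ^+ k = q%:R ^+ (k - 2 * (size u).-1) * q%:R ^+ (2 * (size u).-1) :> R.
  by rewrite -exprD subnK // (leq_trans (leq_addr _ _) le_k).
have := expf_neq0 (2 * (size u).-1) q0; move: (q%:R ^+ (2 * _)) => z z0.
by field.
Qed.

Definition mon e (v : 'rV[F]_e) : {poly F} := 'X^e + rVpoly v.

Lemma monP (e : nat) u : u \is monic -> size u = e.+1 -> exists v : 'rV[F]_e, u = mon v.
Proof.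
move=> um su; exists (poly_rV (u - 'X^e)); rewrite /mon poly_rV_K; first by rewrite addrC subrK.
apply/leq_sizeP => i le_ei; rewrite coefB coefXn.
case: ltngtP le_ei => // [lt _|<- _]; last by move/monicP: um; rewrite lead_coefE su /= => ->; rewrite subrr.
by rewrite subr0 nth_default // su.
Qed.

Lemma size_mon e (v : 'rV[F]_e) : size (mon v) = e.+1.
Proof. by rewrite /mon size_polyDl size_polyXn // ltnS size_rVpoly. Qed.

Lemma mon_monic e (v : 'rV[F]_e) : mon v \is monic.
Proof. by rewrite monicE /mon lead_coefDl ?lead_coefXn // size_polyXn ltnS size_rVpoly. Qed.

(** Two solutions differ by a multiple of u, so a solution is determined by its quotient by u. When
    k < deg u the truncated exponent is 0 and there is at most one solution. *)
Lemma dvd_progression_le k u g m : u != 0 -> coprimep u m ->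
  (#|[set v : 'rV[F]_k | (u %| g + m * rVpoly v)%R]| <= q ^ (k - (size u).-1))%N.
Proof.
move=> unz cop; rewrite -card_rV.
apply: (@leq_card_in _ _ (fun v => poly_rV (rVpoly v %/ u))) => v w; rewrite !inE => dv dw.
move=> /(congr1 rVpoly); have sz (x : 'rV[F]_k) : (size (rVpoly x %/ u)%R <= k - (size u).-1)%N.
  by rewrite size_divp // leq_sub2r // size_rVpoly.
rewrite !poly_rV_K // => e; apply: (can_inj rVpolyK).
have d : u %| rVpoly v - rVpoly w.
  rewrite -(Gauss_dvdpr _ cop).
  have -> : m * (rVpoly v - rVpoly w) = (g + m * rVpoly v) - (g + m * rVpoly w) by ring.
  exact: dvdp_sub.
rewrite (divp_eq (rVpoly v) u) [RHS](divp_eq _ u) e; congr (_ + _).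
by apply/eqP; rewrite -subr_eq0 -modpN -modpD; apply: d.
Qed.

(** As long as the square of a member of s divides A, it is moved into a^2; the degree drops,
    members of s being nonconstant. *)
Lemma square_part s A : A != 0 -> (forall u, u \in s -> u \is monic /\ (1 < size u)%N) ->
  exists a b, [/\ a \is monic, A = a ^+ 2 * b & sqavoid s b].
Proof.
move: {2}(size A) (leqnn (size A)) => n; elim: n A => [|n IH] A.
  by rewrite leqn0 size_poly_eq0 => ->.
move=> leA Anz us; case: (boolP (sqavoid s A)) => [sA|/allPn /= [u us_u]].
  by exists 1, A; rewrite monic1 expr1n mul1r.
have [um u1] := us _ us_u.
rewrite negbK => /dvdpP [b e].
have bnz : b != 0 by apply: contraNneq Anz => b0; rewrite e b0 mul0r.
case: (IH b _ bnz us) => [|a [c [am ec sc]]].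
  have unz : u != 0 by rewrite monic_neq0.
  move: leA; rewrite e size_mul ?expf_neq0 //.
  have aux (x y z : nat) : (1 < x -> 0 < y -> 0 < z -> z.-1 = x.-1 * 2 -> (y + z).-1 <= n.+1 -> y <= n)%N by lia.
  by apply: (aux (size u)) => //; rewrite ?size_exp // size_poly_gt0 // expf_neq0.
exists (a * u), c; split => //; first exact: rpredM.
by rewrite e ec exprMn mulrAC.
Qed.

(** * Lower bound for finite Euler products *)

Section Real.
Variable R : archiRealFieldType.
Local Notation x := (q%:R^-1 : R).

Lemma q_gt0 : 0 < (q%:R : R).
Proof. by rewrite ltr0n (ltn_trans _ (finNzRing_gt1 F)). Qed.

Lemma q_neq0 : (q%:R : R) != 0.
Proof. by rewrite gt_eqF // q_gt0. Qed.

Lemma invq_ge0 : 0 <= x.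
Proof. by rewrite invr_ge0 ltW // q_gt0. Qed.

Lemma invq_le_half : x <= 2^-1.
Proof. by rewrite lef_pV2 ?posrE ?q_gt0 // ler_nat finNzRing_gt1. Qed.

(* Every nonzero polynomial is a^2 b with b avoiding squares from s. *)
Lemma card_nonzero_le s k : (forall u, u \in s -> u \is monic /\ (1 < size u)%N) ->
  (q ^ k - 1 <= \sum_(e < k.+1 | (2 * e <= k)%N) q ^ e * apcount (k - 2 * e) s 0 1)%N.
Proof.
move=> us.
have -> : (q ^ k - 1 = #|[set v : 'rV[F]_k | v != 0%R]|)%N.
  rewrite -card_rV subn1 -(cardsC1 0); apply: eq_card => v; by rewrite !inE.
pose B (e : 'I_k.+1) := (fun wb : 'rV[F]_e * 'rV[F]_(k - 2 * e) =>
  poly_rV (mon wb.1 ^+ 2 * rVpoly wb.2) : 'rV[F]_k) @: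
  setX setT [set v : 'rV[F]_(k - 2 * e) | sqavoid s (0 + 1 * rVpoly v)].
apply: (@leq_trans (\sum_(e < k.+1 | (2 * e <= k)%N) #|B e|)); last first.
  apply: leq_sum => e _; apply: leq_trans (leq_imset_card _ _) _.
  by rewrite cardsX cardsT card_rV.
apply: card_cover => v; rewrite inE => vnz.
have rnz : rVpoly v != 0.
  by apply: contra_neq vnz => v0; apply: (can_inj rVpolyK); rewrite v0 linear0.
have [a [b [am e sb]]] := square_part rnz us.
have anz := monic_neq0 am.
have bnz : b != 0 by apply: contraNneq rnz => b0; rewrite e b0 mulr0.
have sz : ((size a).-1 * 2 + size b <= k)%N.
  have := size_rVpoly v; rewrite e size_mul ?expf_neq0 // -size_exp.
  suff : (0 < size (a ^+ 2))%N by move: (size _) (size _) => m n; lia.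
  by rewrite size_poly_gt0 expf_neq0.
have b0 : (0 < size b)%N by rewrite size_poly_gt0.
have lt_e : ((size a).-1 < k.+1)%N.
  by move: sz b0; move: (size a).-1 (size b) => m n; lia.
have [|w ew] := @monP (Ordinal lt_e) a am; first by rewrite /= prednK // size_poly_gt0.
exists (Ordinal lt_e) => /=; first by move: sz; move: (size a).-1 (size b) => m n; lia.
have szb : (size b <= k - 2 * (Ordinal lt_e))%N.
  by move: sz => /=; move: (size a).-1 (size b) => m n; lia.
apply/imsetP; exists (w, poly_rV b); last by rewrite /= poly_rV_K // -ew -e rVpolyK.
by rewrite !inE /= poly_rV_K // add0r mul1r.
Qed.

(** Over all monic irreducibles the product is 1/zeta(2) = 1 - 1/q for F_q[t]. For a finite list,
    the bound follows by writing each nonzero polynomial of degree < k as a^2 b and counting, for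
    each e = deg a, the b that avoid the squares. *)
Lemma euler_product_ge s : (forall u, u \in s -> u \is monic /\ (1 < size u)%N) ->
  pairwise (@coprimep _) s -> 1 - x <= \prod_(u <- s) (1 - x ^+ (2 * (size u).-1)).
Proof.
move=> us pw.
have us' u : u \in s -> (1 < size u)%N by case/us.
set phi := \prod_(u <- s) _.
have phi0 : 0 <= phi.
  apply: prodr_ge0 => u _; rewrite subr_ge0 exprn_ile1 ?invq_ge0 //.
  by apply: le_trans invq_le_half _; lra.
apply: (@le_of_geometric _ _ _ 2 x); rewrite ?invq_ge0 ?invq_le_half // => j.
set K := (\sum_(u <- s) (2 * (size u).-1))%N.
(* For e < j this leaves k - 2e >= K, the range in which the count is exact. *)
pose k := (2 * j + K)%N.
have cop1 : {in s, forall u, coprimep u 1} by move=> u _; rewrite coprimep1.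
have cnt (n : nat) : (K <= n)%N -> (apcount n s 0 1)%:R = q%:R ^+ n * phi.
  move=> le_n; rewrite (apcountE R 0 us' pw cop1 le_n); congr (_ * _).
  by apply: eq_bigr => u _; rewrite exprVn.
have cnt_le (n : nat) : (apcount n s 0 1)%:R <= q%:R ^+ n :> R.
  by rewrite -natrX ler_nat -card_rV max_card.
have leK (e : nat) : (e < j)%N -> (K <= k - 2 * e)%N.
  by move=> lt_ej; rewrite /k addnC -addnBA ?leq_addr // leq_mul2l ltnW ?orbT.
(* This is the count divided by q^k: exact terms for e < j, the trivial bound q^(k - 2e) for the
   others. Multiplying by 1 - x bounds the sums by 1 and x^j; as x^k <= x^j, the total error is at
   most 2 x^j. *)
have key : 1 - x ^+ k <= \sum_(e < k.+1) x ^+ e * phi + \sum_(e < k.+1 | (j <= e)%N) x ^+ e.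
  have qk0 : 0 < q%:R ^+ k :> R by rewrite exprn_gt0 // q_gt0.
  rewrite -(ler_pM2l qk0) mulrBr mulr1 exprVn mulfV ?gt_eqF //.
  have := card_nonzero_le k us; rewrite leq_subLR -(ler_nat R) natrD natrX -lerBlDl.
  move/le_trans; apply.
  rewrite natr_sum mulrDr !mulr_sumr big_mkcond [X in _ <= _ + X]big_mkcond -big_split /=.
  apply: ler_sum => e _.
  have x_e : 0 <= q%:R ^+ k * (x ^+ e * phi) by rewrite !mulr_ge0 // ?exprn_ge0 ?invq_ge0 // ltW // q_gt0.
  have x_e' : 0 <= q%:R ^+ k * x ^+ e by rewrite !mulr_ge0 // ?exprn_ge0 ?invq_ge0 // ltW // q_gt0.
  case: ifP => [le_e|_]; last by rewrite addr_ge0 //; case: ifP.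
  have ek : q%:R ^+ k * x ^+ e = q%:R ^+ e * q%:R ^+ (k - 2 * e) :> R.
    have -> : q%:R ^+ k = q%:R ^+ e * q%:R ^+ (k - 2 * e) * q%:R ^+ e :> R.
      by rewrite -!exprD; congr (_ ^+ _); lia.
    by rewrite exprVn mulfK // expf_neq0 // q_neq0.
  rewrite natrM natrX mulrA ek; case: ifP => [_|/negbT].
    rewrite -[X in X <= _]add0r lerD //; first by move: x_e; rewrite mulrA ek.
    by rewrite ler_wpM2l // exprn_ge0 // ltW // q_gt0.
  by rewrite -ltnNge addr0 => lt_ej; rewrite cnt ?mulrA //; exact: leK.
have x0 := invq_ge0; have x2 := invq_le_half.
have g0 : (1 - x) * \sum_(e < k.+1) x ^+ e <= 1 := geometric_tail 0 k.+1 x0;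
have gj := geometric_tail j k.+1 x0.
have xkj : x ^+ k <= x ^+ j.
  apply: ler_wiXn2l => //; first by apply: le_trans x2 _; rewrite invf_le1 ?ler1n.
  by rewrite /k mul2n -addnn -addnA leq_addr.
rewrite -mulr_suml in key.
have xk0 := exprn_ge0 k x0.
have x1 : 0 <= 1 - x by rewrite subr_ge0; apply: le_trans x2 _; rewrite invf_le1 ?ler1n.
have /= {}key := ler_wpM2l x1 key.
have /= {}g0 := ler_wpM2r phi0 g0.
have := mulr_ge0 x0 xk0.
lra.
Qed.

End Real.
End Sieve.

(** * Values divisible by the square of an irreducible polynomial of degree at least 2 *)

Section SquareSieve.
Variable F : finFieldType.
Local Notation q := #|F|.
Implicit Types (u g m : {poly F}).

Lemma irreducible_monic_associate u : irreducible_poly u ->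
  exists u', [/\ u' \is monic, irreducible_poly u' & u' %= u].
Proof.
move=> iu; have unz : u != 0 by rewrite -size_poly_gt0; case: iu => /ltnW.
have lnz : (lead_coef u)^-1 != 0 by rewrite invr_eq0 lead_coef_eq0.
have e : (lead_coef u)^-1 *: u %= u by rewrite eqp_scale.
exists ((lead_coef u)^-1 *: u); split => //.
  by rewrite monicE lead_coefZ mulVf // lead_coef_eq0.
case: iu => su du; split => [|d sd dd]; first by rewrite size_scale.
by rewrite (eqp_rtrans e) du // -(eqp_dvdr _ e).
Qed.

(** The degrees run from 2 to r + 1; squares of linear factors are left to the tangency conditions
    at rational points. *)
Definition irreducibles r : seq {poly F} :=
  undup [seq u <- flatten [seq [seq mon v | v <- enum 'rV[F]_e] | e <- seq.iota 2 r]
    | `[< irreducible_poly u >]].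

Lemma mem_irreducibles r u : (u \in irreducibles r) =
  [&& u \is monic, `[< irreducible_poly u >] & (2 < size u < r.+3)%N].
Proof.
rewrite mem_undup mem_filter; case: asboolP => _; rewrite /= ?andbF //.
apply/flattenP/andP => [[s /mapP[e]]|[um /andP [u2 ur]]].
  rewrite mem_iota => e2r -> /mapP [v _ ->]; rewrite mon_monic size_mon; split => //.
have [|v ->] := @monP _ (size u).-1 u um; first by rewrite prednK // (ltn_trans _ u2).
exists [seq mon v | v <- enum 'rV[F]_(size u).-1]; last by rewrite map_f // mem_enum.
apply/mapP; exists (size u).-1 => //; rewrite mem_iota; move: u2 ur; move: (size u) => n; lia.
Qed.

Lemma pairwise_coprime_irreducible (s : seq {poly F}) : uniq s ->
  (forall u, u \in s -> u \is monic /\ irreducible_poly u) -> pairwise (@coprimep _) s.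
Proof.
move=> us ms; move: us; rewrite uniq_pairwise.
apply: (@sub_in_pairwise _ (mem s)); last exact/allP.
move=> u v us vs /= nuv; have [um iu] := ms _ us; have [vm iv] := ms _ vs.
rewrite irreducible_poly_coprime //; apply: contra nuv => duv.
rewrite -eqp_monic //; case: iv => _; apply => //.
by case: iu => su _; rewrite gtn_eqF.
Qed.

Lemma XsubC_irreducible (c : F) : irreducible_poly ('X - c%:P).
Proof.
split; first by rewrite size_XsubC.
move=> d sd dd; rewrite -dvdp_size_eqp // size_XsubC eqn_leq.
have dnz : d != 0 by apply: contraTneq dd => ->; rewrite dvd0p polyXsubC_eq0.
have := dvdp_leq (negbT (polyXsubC_eq0 c)) dd; rewrite size_XsubC => -> /=.
by move: sd; rewrite neq_ltn ltnS leqn0 size_poly_eq0 (negbTE dnz).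
Qed.

Variable R : archiRealFieldType.
Local Notation x := (q%:R^-1 : R).

(** The q linear polynomials X - c are added to the list; their factor (1 - x^2)^q is then divided
    out of the Euler product bound. *)
Lemma irreducibles_product_ge r : (1 - x) * (1 - x ^+ 2) ^- q <=
  \prod_(u <- irreducibles r) (1 - x ^+ (2 * (size u).-1)).
Proof.
pose l := [seq 'X - c%:P | c <- enum F].
have x2 := invq_le_half F R; have x0 := invq_ge0 F R.
have p0 : 0 < 1 - x ^+ 2.
  rewrite subr_gt0 exprn_ilt1 //; apply: le_lt_trans x2 _; rewrite invf_lt1 ?ltr1n //.
have ml u : u \in l ++ irreducibles r -> u \is monic /\ irreducible_poly u.
  rewrite mem_cat mem_irreducibles => /orP [/mapP [c _ ->]|/and3P [? /asboolP]] //.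
  by split; [exact: monicXsubC | exact: XsubC_irreducible].
have pw : pairwise (@coprimep F) (l ++ irreducibles r).
  apply: pairwise_coprime_irreducible => //; rewrite cat_uniq undup_uniq andbT.
  rewrite map_inj_uniq ?enum_uniq; last by move=> c c' /addrI/oppr_inj/polyC_inj.
  apply/hasPn => u; rewrite mem_irreducibles => /and3P [_ _ /andP [u2 _]].
  by apply/mapP => [[c _ e]]; move: u2; rewrite e size_XsubC.
have := @euler_product_ge _ R _ _ pw; rewrite big_cat /=.
have -> : \prod_(u <- l) (1 - x ^+ (2 * (size u).-1)) = (1 - x ^+ 2) ^+ q.
  rewrite big_map big_enum /= -[RHS]prodr_const; apply: eq_bigr => c _.
  by rewrite size_XsubC muln1.
rewrite mulrC => H; rewrite ler_pdivrMr ?exprn_gt0 //; apply: H => u /ml [um [su _]].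
by [].
Qed.

Definition square_bad k g m := [set v : 'rV[F]_k |
  `[< exists u, [/\ irreducible_poly u, (2 < size u)%N & u ^+ 2 %| g + m * rVpoly v] >]].

(** A bad vector falls into one of three classes: the value is divisible by a square from the list,
    the value is 0 (at most one vector), or a nonzero value is divisible by the square of an
    irreducible of large degree e. The last class is bounded by summing over all q^e monic
    polynomials of degree e. *)
Lemma square_bad_cover r N k g m : m != 0 ->
  (forall u, irreducible_poly u -> (2 < size u)%N -> coprimep u m) ->
  (size m <= N.+1)%N -> (size g <= k + N)%N ->
  (#|square_bad k g m| + apcount k (irreducibles r) g m <=
    q ^ k + 1 + \sum_(e < (k + N).+1 | (r <= e)%N) q ^ (k + N - e))%N.
Proof.
move=> mnz cop sm sg.
pose S := [set v : 'rV[F]_k | sqavoid (irreducibles r) (g + m * rVpoly v)].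
pose Z := [set v : 'rV[F]_k | g + m * rVpoly v == 0].
pose T := [set v : 'rV[F]_k | (v \in square_bad k g m) && (v \notin Z) && (v \in S)].
have leZ : (#|Z| <= 1)%N.
  apply/card_le1_eqP => v w; rewrite !inE => /eqP e1 /eqP e2; apply: (can_inj rVpolyK).
  by apply: (mulfI mnz); apply: (@addrI _ g); rewrite e1 e2.
have le1 : (#|square_bad k g m| <= #|~: S| + #|Z| + #|T|)%N.
  apply: (@leq_trans #|~: S :|: Z :|: T|).
    apply/subset_leq_card/subsetP => v vb; rewrite !in_setU in_setC [v \in T]inE vb /=.
    by case: (v \in S) => //; case: (v \in Z).
  apply: leq_trans (leq_card_setU _ _) _; rewrite leq_add2r; exact: leq_card_setU.
have cS : (#|S| + #|~: S| = q ^ k)%N by rewrite cardsC card_rV.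
suff leT : (#|T| <= \sum_(e < (k + N).+1 | (r <= e)%N) q ^ (k + N - e))%N.
  rewrite -[apcount _ _ _ _]/#|S|; move: cS le1 leZ leT.
  move: #|S| #|~: S| #|Z| #|T| #|square_bad _ _ _| (q ^ k)%N (\sum_(e < _ | _) _)%N; lia.
pose D e (w : 'rV[F]_e) := [set v : 'rV[F]_k | mon w ^+ 2 %| g + m * rVpoly v].
pose B (e : 'I_(k + N).+1) := \bigcup_(w : 'rV[F]_e | coprimep (mon w) m) D e w.
apply: (@leq_trans (\sum_(e < (k + N).+1 | (r <= e)%N && (2 * e <= k + N)%N) #|B e|)); last first.
  rewrite big_mkcondr /=; apply: leq_sum => e _; case: ifP => // le_e.
  apply: (@leq_trans (\sum_(w : 'rV[F]_e) q ^ (k - 2 * e))); last first.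
    (* The subtraction k - 2e is truncated: when 2e > k the exponent is just e, and 2e <= k + N
       bounds it by k + N - e. *)
    rewrite sum_nat_const card_rV -expnD leq_pexp2l ?(ltn_trans _ (finNzRing_gt1 F)) //; lia.
  apply: (@leq_trans (\sum_(w : 'rV[F]_e | coprimep (mon w) m) q ^ (k - 2 * e))); last first.
    by rewrite [X in (_ <= X)%N](bigID (fun w : 'rV[F]_e => coprimep (mon w) m)) leq_addr.
  apply: (@leq_trans (\sum_(w : 'rV[F]_e | coprimep (mon w) m) #|D e w|)).
    by apply: card_cover => v /bigcupP [w cw vw]; exists w.
  apply: leq_sum => w cw.
  have := @dvd_progression_le _ k (mon w ^+ 2) g m.
  rewrite size_exp size_mon mulnC /=; apply; last exact: coprimep_expl.
  by rewrite expf_neq0 // monic_neq0 // mon_monic.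
apply: card_cover => v; rewrite !inE => /andP [/andP [/asboolP [u [iu su du]] vnz] /allP /= vS].
have [u' [um iu' eu]] := irreducible_monic_associate iu.
have su' : size u' = size u by apply: eqp_size.
have du' : u' ^+ 2 %| g + m * rVpoly v by rewrite (eqp_dvdl _ (eqp_exp 2 eu)).
have lsu : (r.+2 < size u)%N.
  rewrite ltnNge; apply/negP => ler; have := vS u'; rewrite mem_irreducibles um su' su ltnS ler.
  by rewrite du' (asboolT iu') => /(_ isT).
have szf : (size (g + m * rVpoly v)%R <= k + N)%N.
  apply: leq_trans (size_polyD _ _) _; rewrite geq_max sg /=.
  apply: leq_trans (size_polyMleq _ _) _; have := size_rVpoly v; move: sm.
  by move: (size m) (size (rVpoly v)) => a b; lia.
have sz2 : ((size u).-1 * 2 < k + N)%N.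
  rewrite -su' -size_exp prednK; last by rewrite size_poly_gt0 expf_neq0 // monic_neq0.
  exact: leq_trans (dvdp_leq vnz du') szf.
have lt_e : ((size u).-1 < (k + N).+1)%N by move: sz2; move: (size u) => a; lia.
have [|w ew] := @monP _ (Ordinal lt_e) u' um; first by rewrite /= su' prednK // (ltn_trans _ su).
exists (Ordinal lt_e) => /=; first by move: sz2 lsu; move: (size u) => a; lia.
apply/bigcupP; exists w; first by rewrite -ew cop // su'.
by rewrite inE -ew.
Qed.

(* The main term comes from the Euler product over the irreducible polynomials of
   degree between 2 and r + 1, the error term 3 q^N / q^r from larger squares. *)
Lemma square_sieve r N : exists k0, forall k g m, (k0 <= k)%N -> m != 0 ->
  (forall u, irreducible_poly u -> (2 < size u)%N -> coprimep u m) ->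
  (size m <= N.+1)%N -> (size g <= k + N)%N ->
  #|square_bad k g m|%:R <=
    q%:R ^+ k * (1 - (1 - x) * (1 - x ^+ 2) ^- q + 3 * q%:R ^+ N * x ^+ r).
Proof.
(* The sum makes the count over the list exact; the summand r lets the single zero value be absorbed
   into the error term. *)
exists (r + \sum_(u <- irreducibles r) (2 * (size u).-1))%N => k g m le_k mnz cop sm sg.
have le_rk : (r <= k)%N := leq_trans (leq_addr _ _) le_k.
have ps : pairwise (@coprimep F) (irreducibles r).
  apply: pairwise_coprime_irreducible; first exact: undup_uniq.
  by move=> u; rewrite mem_irreducibles => /and3P [? /asboolP].
have := square_bad_cover r mnz cop sm sg.
rewrite -(ler_nat R) !natrD natrX apcountE //; first last.
- exact: leq_trans (leq_addl _ _) le_k.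
- by move=> u; rewrite mem_irreducibles => /and3P [_ /asboolP ? /andP [? _]]; exact: cop.
- by move=> u; rewrite mem_irreducibles => /and3P [_ _ /andP [? _]]; exact: ltnW.
have := irreducibles_product_ge r; rewrite -/q.
under eq_bigr do rewrite exprVn.
set p := \prod_(u <- _) _ => le_p.
have q0 := q_gt0 F R; have qn0 := q_neq0 F R.
have x2 := invq_le_half F R; have x0 := invq_ge0 F R.
have qk0 : 0 < q%:R ^+ k :> R by rewrite exprn_gt0.
have qN0 : 1 <= q%:R ^+ N :> R by rewrite exprn_ege1 // ler1n; apply: ltnW; apply: finNzRing_gt1.
have aux (n e : nat) : (e <= n)%N -> q%:R ^+ (n - e) = q%:R ^+ n * x ^+ e :> R.
  by move=> le_en; rewrite -{2}(subnK le_en) exprD exprVn mulfK // expf_neq0.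
have -> : (\sum_(e < (k + N).+1 | (r <= e)%N) q ^ (k + N - e))%:R =
   q%:R ^+ k * (q%:R ^+ N * \sum_(e < (k + N).+1 | (r <= e)%N) x ^+ e) :> R.
  rewrite natr_sum !mulr_sumr; apply: eq_bigr => e _.
  by rewrite natrX mulrA -exprD aux // -ltnS.
have := geometric_tail r (k + N).+1 x0.
move: (\sum_(e < _ | _) _) => S gS.
have xr0 := exprn_ge0 r x0.
(* Since 1 - x >= 1/2, the tail contributes 2 to the constant 3; the zero value contributes 1. *)
have leS : S <= 2 * x ^+ r.
  have : 2^-1 * S <= (1 - x) * S \/ S <= 0.
    case: (lerP S 0) => [|S0]; [by right|left]; rewrite ler_pM2r //; lra.
  case => [|]; lra.
have le1 : 1 <= q%:R ^+ k * (q%:R ^+ N * x ^+ r).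
  have e1 : q%:R ^+ r * x ^+ r = 1 :> R by rewrite -exprMn divff ?expr1n.
  rewrite -[leLHS]e1.
  rewrite mulrA ler_pM2r; last by rewrite exprn_gt0 // invr_gt0.
  rewrite -[leLHS]mulr1; apply: ler_pM => //; first exact/exprn_ge0/ltW.
  by rewrite ler_weXn2l // ler1n ltnW // finNzRing_gt1.
have h1 : q%:R ^+ k * (q%:R ^+ N * S) <= 2 * (q%:R ^+ k * (q%:R ^+ N * x ^+ r)).
  rewrite [leRHS]mulrCA ler_pM2l // [leRHS]mulrCA ler_pM2l //; exact: lt_le_trans ltr01 qN0.
have h2 := ler_wpM2l (ltW qk0) le_p.
rewrite /= in h2; move: h1 h2 le1 => h1 h2 le1 h3.
lra.
Qed.

End SquareSieve.

(** * Replacing tangencies by independent incidences *)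

Section Incidences.
Variables (R : realFieldType) (T : finType) (inc : rel T).
Variables (p s : R).

(** This is the law of the model event at (P, L): it has probability p if P lies on L, and 0
    otherwise. *)
Definition incidence_weight (P L : T) (e : bool) : R :=
  if e then p *+ inc P L else 1 - p *+ inc P L.

(** In the independent model this is the expectation of a factor equal to 1 if some event occurs on
    L and to 1 - s if none does. *)
Lemma sum_incidence_weight L :
  \sum_(c : {ffun T -> bool}) (\prod_P incidence_weight P L (c P)) *
    (if [exists P, c P] then 1 else 1 - s) = 1 - s * \prod_P (1 - p *+ inc P L).
Proof.
have tot : \sum_(c : {ffun T -> bool}) \prod_P incidence_weight P L (c P) = 1.
  rewrite -(bigA_distr_bigA (fun P e => incidence_weight P L e)) /=.
  by apply: big1 => P _; rewrite big_bool /incidence_weight /= addrC subrK.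
pose c0 : {ffun T -> bool} := [ffun=> false].
rewrite (bigD1 c0) //= -[X in _ = X - _]tot [in RHS](bigD1 c0) //=.
have -> : [exists P, c0 P] = false by apply/existsP => [[P]]; rewrite ffunE.
have -> : \prod_P (1 - p *+ inc P L) = \prod_P incidence_weight P L (c0 P).
  by apply: eq_bigr => P _; rewrite ffunE.
rewrite [X in _ + X](_ : _ = \sum_(c | c != c0) \prod_P incidence_weight P L (c P)); first by ring.
apply: eq_bigr => c nc; case: ifP => [_|/negbT]; first by rewrite mulr1.
rewrite negb_exists => /forallP c0P; case/eqP: nc; apply/ffunP => P.
by rewrite ffunE; apply/negbTE/c0P.
Qed.

(** Patterns are indexed by point first, the factors by line. Transposing makes the columns
    independent, so the sum factorises. *)
Lemma sum_transpose (G : T -> {ffun T -> bool} -> R) :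
  \sum_(E : {ffun T -> {ffun T -> bool}}) \prod_L G L [ffun P => E P L] =
  \prod_L \sum_(c : {ffun T -> bool}) G L c.
Proof.
rewrite bigA_distr_bigA /=.
pose tr (E : {ffun T -> {ffun T -> bool}}) := [ffun L => [ffun P => E P L]].
have trK : involutive tr by move=> E; apply/ffunP => L; apply/ffunP => P; rewrite !ffunE.
rewrite (reindex_inj (inv_inj trK)); apply: eq_bigr => E _; apply: eq_bigr => L _.
by congr (G L _); apply/ffunP => P; rewrite !ffunE.
Qed.

Lemma sum_prod_indicator (V : finType) (X : T -> pred V) :
  \sum_(h : {ffun T -> V}) \prod_L (X L (h L))%:R = \prod_L #|[set x | X L x]|%:R :> R.
Proof.
rewrite -(bigA_distr_bigA (fun L x => (X L x)%:R : R)); apply: eq_bigr => L _.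
by rewrite -natr_sum -sum1_card [in RHS]big_mkcond; congr (_%:R);
  apply: eq_bigr => x _; rewrite inE; case: (X L x).
Qed.

(** T indexes both points and lines; U holds the data at a point, H the data on a line. For fixed
    point data the conditions on the line data are independent over the lines. The point data are
    then grouped by tangency pattern, and [loc] replaces the number of data with a given pattern by
    C^#|T| times the independent model. *)
Lemma incidence_bound (U H : finType) (ns : T -> pred U) (tg : T -> U -> pred T)
    (bad : {ffun T -> U} -> T -> {set H}) (S : {set {ffun T -> U} * {ffun T -> H}}) (C : R) :
  0 <= p <= 1 -> 0 <= C -> s <= 1 ->
  (forall y, y \in S -> forall P, ns P (y.1 P)) ->
  (forall y, y \in S -> forall L, [exists P, tg P (y.1 P) L] || (y.2 L \in bad y.1 L)) ->
  (forall l L, (#|bad l L|)%:R <= (1 - s) * #|H|%:R) ->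
  (forall P (E : {ffun T -> bool}), (#|[set x | ns P x && [forall L, tg P x L == E L]]|)%:R
     <= C * #|U|%:R * \prod_L incidence_weight P L (E L)) ->
  #|S|%:R <= (C * #|U|%:R * #|H|%:R) ^+ #|T| * \prod_L (1 - s * \prod_P (1 - p *+ inc P L)).
Proof.
move=> p01 C0 s1 Sns Stg bad_le loc.
pose phi (c : pred T) : R := if [exists P, c P] then 1 else 1 - s.
have phi0 c : 0 <= phi c by rewrite /phi; case: ifP => _; rewrite ?ler01 // subr_ge0.
pose X (l : {ffun T -> U}) L : pred H := fun h => [exists P, tg P (l P) L] || (h \in bad l L).
have X_le (l : {ffun T -> U}) L : #|[set x | X l L x]|%:R <= #|H|%:R * phi (fun P => tg P (l P) L).
  rewrite /phi /X; case: ifP => _; first by rewrite mulr1 ler_nat max_card.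
  rewrite mulrC; apply: le_trans (bad_le l L); rewrite ler_nat; apply/eq_leq/eq_card => x.
  by rewrite inE.
pose n (l : {ffun T -> U}) : R := \prod_P (ns P (l P))%:R.
have n0 l : 0 <= n l by apply: prodr_ge0.
pose Et (l : {ffun T -> U}) : {ffun T -> {ffun T -> bool}} := [ffun P => [ffun L => tg P (l P) L]].
(* The line data are summed out: each line contributes #|H| if it is tangent at some point, and at
   most (1 - s) #|H| otherwise. *)
have step1 : #|S|%:R <= \sum_l n l * (#|H|%:R ^+ #|T| * \prod_L phi (fun P => tg P (l P) L)).
  apply: (@le_trans _ _ (\sum_l n l * \sum_(h : {ffun T -> H}) \prod_L (X l L (h L))%:R)); last first.
    apply: ler_sum => l _; apply: ler_wpM2l => //; rewrite (sum_prod_indicator (X l)) -prodr_const -big_split /=.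
    apply: ler_prod => L _; rewrite ler0n /=; exact: X_le.
  under eq_bigr do rewrite mulr_sumr.
  rewrite pair_bigA /= -sum1_card natr_sum big_mkcond /=.
  apply: ler_sum => -[l h] _; case: ifP => [yS|_]; last by rewrite mulr_ge0 // prodr_ge0.
  rewrite /n big1 ?mul1r; last by move=> P _; rewrite (Sns _ yS P).
  by rewrite big1 // => L _; rewrite /X (Stg _ yS L).
apply: le_trans step1 _.
rewrite (partition_big Et predT) //=.
(* The factor of the lines depends only on the pattern E, so the point data with that pattern can be
   counted point by point. *)
have step2 (E : {ffun T -> {ffun T -> bool}}) :
  \sum_(l | Et l == E) n l * (#|H|%:R ^+ #|T| * \prod_L phi (fun P => tg P (l P) L)) <=
  (C * #|U|%:R * #|H|%:R) ^+ #|T| * \prod_L ((\prod_P incidence_weight P L (E P L)) * phi (fun P => E P L)).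
  have -> : \sum_(l | Et l == E) n l * (#|H|%:R ^+ #|T| * \prod_L phi (fun P => tg P (l P) L)) =
     (\sum_(l : {ffun T -> U}) \prod_P (ns P (l P) && [forall L, tg P (l P) L == E P L])%:R) *
      (#|H|%:R ^+ #|T| * \prod_L phi (fun P => E P L)).
    rewrite mulr_suml big_mkcond; apply: eq_bigr => l _; case: ifPn => [/eqP e|ne].
      congr (_ * (_ * _)); last first.
        apply: eq_bigr => L _; rewrite /phi; congr (if _ then _ else _).
        by apply: eq_existsb => P; rewrite -e !ffunE.
      apply: eq_bigr => P _; congr (nat_of_bool _)%:R; rewrite -[LHS]andbT; congr (_ && _).
      by apply/esym/forallP => L; rewrite -e !ffunE.
    suff -> : \prod_P (ns P (l P) && [forall L, tg P (l P) L == E P L])%:R = 0 :> R by rewrite mul0r.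
    have /existsP [P nP] : [exists P, ~~ [forall L, tg P (l P) L == E P L]].
      apply: contraNT ne; rewrite negb_exists => /forallP H0.
      apply/eqP/ffunP => P; apply/ffunP => L; rewrite !ffunE.
      by have := H0 P; rewrite negbK => /forallP /(_ L) /eqP.
    by rewrite (bigD1 P) //= (negbTE nP) andbF mul0r.
  rewrite (sum_prod_indicator (fun P x => ns P x && [forall L, tg P x L == E P L])) big_split /= !exprMn.
  rewrite (exchange_big_dep predT) //=.
  rewrite mulrA [leRHS]mulrA; apply: ler_wpM2r; first exact: prodr_ge0.
  rewrite [leRHS]mulrAC; apply: ler_wpM2r; first exact: exprn_ge0.
  rewrite -exprMn -prodr_const -big_split /=; apply: ler_prod => P _; rewrite ler0n /=.
  exact: loc.
apply: le_trans (ler_sum _ (fun E _ => step2 E)) _.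
rewrite -mulr_sumr; apply: ler_wpM2l; first by rewrite exprn_ge0 // !mulr_ge0.
rewrite le_eqVlt; apply/orP; left; apply/eqP.
rewrite -[RHS](eq_bigr _ (fun L _ => sum_incidence_weight L)) -sum_transpose.
apply: eq_bigr => E _; apply: eq_bigr => L _; congr (_ * _).
  by apply: eq_bigr => P _; rewrite ffunE.
by rewrite /phi; congr (if _ then _ else _); apply: eq_existsb => P; rewrite ffunE.
Qed.

End Incidences.

Module PlaneGeometry.
Import mpoly.

(** * Homogeneous polynomials and their restrictions to lines *)

Section Homogeneous.
Variables (n : nat) (K : fieldType).
Implicit Types (f g : {mpoly K[n]}) (v : 'I_n -> K).

(** Monomials are built one variable at a time, and a homogeneous polynomial is a combination of
    monomials of its degree. The identities below are all checked on these generators. *)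
Lemma dhomog_induction (Q : nat -> {mpoly K[n]} -> Prop) :
  Q 0 1 -> (forall d, Q d 0) ->
  (forall d f i, f \is d.-homog -> Q d f -> Q d.+1 (f * 'X_i)) ->
  (forall d c f g, f \is d.-homog -> Q d f -> Q d g -> Q d (c *: f + g)) ->
  forall d f, f \is d.-homog -> Q d f.
Proof.
move=> Q1 Q0 QX QD.
have QM d m : mdeg m = d -> Q d 'X_[m].
  elim: d m => [|d IH] m dm.
    by move/eqP: dm; rewrite mdeg_eq0 => /eqP ->; rewrite mpolyX0.
  have [i mi] : exists i, (0 < m i)%N.
    apply/existsP; apply: contra_eqT dm; rewrite negb_exists => /forallP m0.
    by rewrite mdegE big1 // => i _; apply/eqP; rewrite -leqn0 leqNgt.
  have e : (m - U_(i) + U_(i))%MM = m by apply: submK; rewrite lep1mP -lt0n.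
  have dm' : mdeg (m - U_(i)) = d by have := mdegD (m - U_(i))%MM U_(i); rewrite e dm mdeg1 addn1 => -[].
  rewrite -e mpolyXD; apply: QX; last exact: IH.
  by rewrite dhomogX; apply/eqP.
move=> d f /dhomogP hf; rewrite (mpolyE f) big_seq.
elim/big_rec: _ => [|m g mf Qg]; first exact: Q0.
by apply: QD => //; [rewrite dhomogX; apply/eqP/hf | apply/QM/hf].
Qed.

Lemma dhomog_scale d f c v : f \is d.-homog -> f.@[fun i => c * v i] = c ^+ d * f.@[v].
Proof.
move: d f; apply: dhomog_induction => [|d|d f i _ IH|d a f g _ IHf IHg].
- by rewrite !meval1 mul1r.
- by rewrite !meval0 mulr0.
- rewrite !mevalM !mevalXU IH exprS; ring.
- rewrite !mevalD !mevalZ IHf IHg; ring.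
Qed.

Lemma mderivXU (i j : 'I_n) : ('X_i : {mpoly K[n]})^`M(j) = ((i == j)%:R)%:MP.
Proof.
rewrite mderivX mnm1E; case: eqVneq => [->|_]; last by rewrite scale0r mpolyC0.
have -> : (U_(j) - U_(j))%MM = 0%MM :> 'X_{1..n} by apply/mnmP => k; rewrite mnmBE mnm0E subnn.
by rewrite scale1r mpolyX0.
Qed.

(** The factor c on the left avoids the exponent d - 1, which would be wrong for d = 0. *)
Lemma dhomog_deriv_scale d f c v j : f \is d.-homog ->
  c * (f^`M(j)).@[fun i => c * v i] = c ^+ d * (f^`M(j)).@[v].
Proof.
move: d f; apply: dhomog_induction => [|d|d f i hf IH|d a f g _ IHf IHg].
- by rewrite -mpolyC1 mderivC !meval0 !mulr0.
- by rewrite mderiv0 !meval0 !mulr0.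
- rewrite !mderivM !mevalD !mevalM !mevalXU mderivXU !mevalC.
  rewrite (dhomog_scale _ _ hf) mulrDr mulrA IH exprS; ring.
- rewrite !mderivD !mderivZ !mevalD !mevalZ mulrDr mulrCA IHf IHg; ring.
Qed.

(** Euler's identity. Where f vanishes it makes the derivative along v zero in every
    characteristic. *)
Lemma euler d f v : f \is d.-homog -> \sum_i v i * (f^`M(i)).@[v] = d%:R * f.@[v].
Proof.
move: d f; apply: dhomog_induction => [|d|d f i _ IH|d a f g _ IHf IHg].
- by rewrite mul0r big1 // => i _; rewrite -mpolyC1 mderivC meval0 mulr0.
- by rewrite meval0 mulr0 big1 // => i _; rewrite mderiv0 meval0 mulr0.
- rewrite mevalM mevalXU -addn1 natrD mulrDl mul1r mulrA -IH mulr_suml.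
  rewrite (eq_bigr (fun j => v j * (f^`M(j)).@[v] * v i + v j * f.@[v] * (i == j)%:R)); last first.
    by move=> j _; rewrite mderivM mderivXU mevalD !mevalM mevalXU mevalC; ring.
  rewrite big_split /=; congr (_ + _).
  rewrite (bigD1 i) //= eqxx mulr1 big1 ?addr0 1?mulrC // => j nj.
  by rewrite eq_sym (negbTE nj) mulr0.
- rewrite mevalD mevalZ mulrDr mulrCA -IHf -IHg mulr_sumr -big_split /=.
  by apply: eq_bigr => i _; rewrite mderivD mderivZ mevalD mevalZ; ring.
Qed.

Lemma meval_map_mpoly (L : fieldType) (phi : {rmorphism K -> L}) f v :
  (map_mpoly phi f).@[fun i => phi (v i)] = phi f.@[v].
Proof.
rewrite [in RHS]mevalE rmorph_sum /map_mpoly /mmap raddf_sum; apply: eq_bigr => m _ /=.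
rewrite mmap1_id mevalM mevalC mevalX rmorphM rmorph_prod; congr (_ * _).
by apply: eq_bigr => i _; rewrite rmorphXn.
Qed.

Definition linf (b : 'I_n -> K) : {mpoly K[n]} := \sum_i b i *: 'X_i.
Definition dot (a v : 'I_n -> K) : K := \sum_i a i * v i.

Lemma linfE b v : (linf b).@[v] = dot b v.
Proof. by rewrite /linf raddf_sum; apply: eq_bigr => i _; rewrite /= mevalZ mevalXU. Qed.

Lemma linf_homog b : linf b \is 1.-homog.
Proof. by apply: rpred_sum => i _; apply: rpredZ; rewrite dhomogX /= mdeg1. Qed.

Lemma linf_deriv b j : (linf b)^`M(j) = (b j)%:MP.
Proof.
rewrite /linf raddf_sum /= (bigD1 j) //= big1 ?addr0 => [|i nij].
  by rewrite mderivZ mderivXU eqxx -mul_mpolyC -mpolyCM mulr1.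
by rewrite mderivZ mderivXU (negbTE nij) mpolyC0 scaler0.
Qed.

Lemma prod_homog (I : finType) (P : pred I) (G : I -> {mpoly K[n]}) :
  (forall i, P i -> G i \is 1.-homog) -> \prod_(i | P i) G i \is (#|[pred i | P i]|).-homog.
Proof.
move=> hG; rewrite -sum1_card; elim/big_rec2: _ => [|i d f Pi hf]; first exact: dhomog1.
by apply: dhomogM => //; apply: hG.
Qed.

(** The restriction of f to the line through u and w, in the coordinate t of the point u + t w; the
    point w lies at t = infinity. *)
Definition restr (u w : 'I_n -> K) f : {poly K} :=
  mmap polyC (fun i => (u i)%:P + w i *: 'X) f.

Lemma restrX u w i : restr u w 'X_i = (u i)%:P + w i *: 'X.
Proof. by rewrite /restr mmapX mmap1U. Qed.

Lemma restrM u w f g : restr u w (f * g) = restr u w f * restr u w g.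
Proof. exact: rmorphM. Qed.

Lemma restrD u w f g : restr u w (f + g) = restr u w f + restr u w g.
Proof. exact: raddfD. Qed.

Lemma restrZ u w c f : restr u w (c *: f) = c *: restr u w f.
Proof. by rewrite /restr mmapZ mul_polyC. Qed.

Lemma restr_linf u w b : restr u w (linf b) = (dot b u)%:P + dot b w *: 'X.
Proof.
rewrite /restr /linf raddf_sum /dot raddf_sum /= scaler_suml -big_split /=.
by apply: eq_bigr => i _; rewrite mmapZ mmapX mmap1U mulrDr -!mul_polyC !polyCM !mulrA.
Qed.

Lemma size_restr d f u w : f \is d.-homog -> (size (restr u w f) <= d.+1)%N.
Proof.
move: d f; apply: dhomog_induction => [|d|d f i _ IH|d a f g _ IHf IHg].
- by rewrite /restr rmorph1 size_poly1.
- by rewrite /restr raddf0 size_poly0.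
- rewrite restrM restrX; apply: leq_trans (size_polyMleq _ _) _.
  have : (size ((u i)%:P + w i *: 'X : {poly K})%R <= 2)%N.
    apply: leq_trans (size_polyD _ _) _; rewrite geq_max (leq_trans (size_polyC_leq1 _)) //.
    by rewrite (leq_trans (size_scale_leq _ _)) // size_polyX.
  move: (size _) (size (restr u w f)) IH => a b; lia.
- rewrite restrD restrZ; apply: leq_trans (size_polyD _ _) _.
  by rewrite geq_max IHg (leq_trans (size_scale_leq _ _)).
Qed.

(** Exchanging u and w reverses the binary form, so the top coefficients give access to the point at
    infinity w. *)
Lemma restr_rev d f u w j : f \is d.-homog -> (j <= d)%N ->
  (restr u w f)`_j = (restr w u f)`_(d - j).
Proof.
move=> hf; move: d f hf j; apply: dhomog_induction => [|d|d f i hf IH|d a f g _ IHf IHg] j.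
- by rewrite leqn0 => /eqP ->; rewrite /restr !rmorph1.
- by rewrite /restr !raddf0 !coef0.
- move=> le_jd; rewrite !restrM !restrX !mulrDr !coefD -!scalerAr !coefZ !coefMC !coefMX.
  case: j le_jd => [_|j le_jd] /=.
    by rewrite subn0 /= mulr0 addr0 [in RHS]nth_default ?size_restr // mul0r add0r mulrC IH // subn0.
  rewrite subSS; case: (ltngtP j d) => [lt_jd|lt_dj|->].
  + rewrite (IH j.+1) // (IH j) ?(ltnW lt_jd) //.
    have -> : (d - j = (d - j.+1).+1)%N by rewrite subnSK.
    by rewrite /=; ring.
  + by move: le_jd; rewrite ltnS leqNgt lt_dj.
  + by rewrite subnn /= mulr0 addr0 nth_default ?size_restr // mul0r add0r mulrC IH // subnn.
- by move=> le_jd; rewrite !restrD !restrZ !coefD !coefZ IHf // IHg.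
Qed.

Lemma restr_deriv d f u w : f \is d.-homog ->
  (restr u w f)^`() = \sum_i w i *: restr u w (f^`M(i)).
Proof.
move: d f; apply: dhomog_induction => [|d|d f i _ IH|d a f g _ IHf IHg].
- by rewrite /restr rmorph1 derivC big1 // => i _; rewrite -mpolyC1 mderivC raddf0 scaler0.
- by rewrite /restr raddf0 deriv0 big1 // => i _; rewrite mderiv0 raddf0 scaler0.
- rewrite restrM derivM IH restrX derivD derivC derivZ derivX add0r.
  rewrite [RHS](eq_bigr (fun j => (w j *: restr u w f^`M(j)) * restr u w 'X_i +
    (i == j)%:R *: (w i *: restr u w f))); last first.
    move=> j _; rewrite mderivM mderivXU restrD !restrM scalerDr scalerAl; congr (_ + _).
    rewrite /restr mmapC; case: eqVneq => [->|_]; first by rewrite mulr1 scale1r.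
    by rewrite mulr0 scaler0 scale0r.
  rewrite big_split /= -mulr_suml restrX; congr (_ + _).
  rewrite (bigD1 i) //= eqxx scale1r big1 ?addr0 => [|j nj].
    by rewrite alg_polyC mulrC mul_polyC.
  by rewrite eq_sym (negbTE nj) scale0r.
- rewrite restrD restrZ derivD derivZ IHf IHg scaler_sumr -big_split /=.
  apply: eq_bigr => i _; rewrite mderivD mderivZ restrD restrZ scalerDr !scalerA.
  by rewrite [a * _]mulrC.
Qed.

Lemma horner_restr (L : fieldType) (phi : {rmorphism K -> L}) f u w t :
  (map_poly phi (restr u w f)).[t] = (map_mpoly phi f).@[fun i => phi (u i) + t * phi (w i)].
Proof.
rewrite /restr /map_mpoly /mmap !raddf_sum /= horner_sum; apply: eq_bigr => m _ /=.
rewrite mmap1_id mevalM mevalC mevalX rmorphM /= map_polyC hornerM hornerC; congr (_ * _).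
rewrite /mmap1 rmorph_prod horner_prod; apply: eq_bigr => i _.
rewrite rmorphXn horner_exp rmorphD /= map_polyC map_polyZ map_polyX !hornerE.
by rewrite mulrC.
Qed.

Lemma restr_horner f u w t : (restr u w f).[t] = f.@[fun i => u i + t * w i].
Proof.
have := @horner_restr K idfun f u w t; rewrite map_poly_id // => ->; congr (meval _ _).
by apply/mpolyP => m; rewrite mcoeff_map_mpoly.
Qed.

End Homogeneous.

(** * The projective plane over a finite field *)

Section Plane.
Variable F : finFieldType.
Local Notation q := #|F|.

Local Notation i0 := (@Ordinal 3 0 isT).
Local Notation i1 := (@Ordinal 3 1 isT).
Local Notation i2 := (@Ordinal 3 2 isT).

Lemma forall_ord3 (Q : 'I_3 -> Prop) : Q i0 -> Q i1 -> Q i2 -> forall i, Q i.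
Proof.
move=> Q0 Q1 Q2 [[|[|[|//]]] lt_i].
- by rewrite (_ : Ordinal _ = i0) //; exact: val_inj.
- by rewrite (_ : Ordinal _ = i1) //; exact: val_inj.
- by rewrite (_ : Ordinal _ = i2) //; exact: val_inj.
Qed.

Lemma sum_ord3 (V : nmodType) (G : 'I_3 -> V) : \sum_i G i = G i0 + G i1 + G i2.
Proof.
rewrite !big_ord_recr big_ord0 /= add0r.
by congr (G _ + G _ + G _); exact: val_inj.
Qed.

Definition vec3 (V : Type) (a b c : V) (i : 'I_3) : V :=
  match val i with 0%N => a | 1%N => b | _ => c end.

(* Normalised homogeneous coordinates: a point, or dually a line, of the
   projective plane over F is (1:x:y), (0:1:x) or (0:0:1). *)
Definition plane : finType := ((F * F) + (F + unit))%type.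

Implicit Types (P L : plane).

Definition rep P : 'I_3 -> F :=
  match P with
  | inl (x, y) => vec3 1 x y
  | inr (inl x) => vec3 0 1 x
  | inr (inr _) => vec3 0 0 1
  end.

Definition pivot P : 'I_3 :=
  match P with inl _ => i0 | inr (inl _) => i1 | inr (inr _) => i2 end.
(** [coord1] and [coord2] are the two indices other than [pivot]. Solving the equation of a line for
    its pivot coordinate leaves them as coordinates on the line, with [basis1] and [basis2] as the
    dual basis. *)
Definition coord1 P : 'I_3 := match P with inl _ => i1 | inr _ => i0 end.
Definition coord2 P : 'I_3 := match P with inr (inr _) => i1 | _ => i2 end.

Definition basis1 L : 'I_3 -> F :=
  match L with inl (x, y) => vec3 (- x) 1 0 | inr _ => vec3 1 0 0 end.
Definition basis2 L : 'I_3 -> F :=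
  match L with
  | inl (x, y) => vec3 (- y) 0 1
  | inr (inl x) => vec3 0 (- x) 1
  | inr (inr _) => vec3 0 1 0
  end.

Lemma card_plane : #|plane| = (q ^ 2 + q + 1)%N.
Proof. by rewrite !card_sum card_prod card_unit mulnn addnA. Qed.

Lemma rep_pivot P : rep P (pivot P) = 1.
Proof. by case: P => [[x y]|[x|[]]]. Qed.

Lemma rep_neq0 P : exists i, rep P i != 0.
Proof. by exists (pivot P); rewrite rep_pivot oner_neq0. Qed.

Lemma rep_normalise (v : 'I_3 -> F) : (exists i, v i != 0) ->
  exists P (c : F), c != 0 /\ forall i, v i = c * rep P i.
Proof.
have [v0|nv0] := eqVneq (v i0) 0; last first.
  exists (inl (v i1 / v i0, v i2 / v i0)), (v i0); split => //.
  by apply: forall_ord3; rewrite /rep /vec3 /= ?mulr1 // mulrCA divff // mulr1.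
have [v1|nv1] := eqVneq (v i1) 0; last first.
  exists (inr (inl (v i2 / v i1))), (v i1); split => //.
  by apply: forall_ord3; rewrite /rep /vec3 /= ?mulr1 ?mulr0 // mulrCA divff // mulr1.
have [v2|nv2] := eqVneq (v i2) 0; last first.
  exists (inr (inr tt)), (v i2); split => //.
  by apply: forall_ord3; rewrite /rep /vec3 /= ?mulr1 ?mulr0.
move=> [i]; suff -> : v i = 0 by rewrite eqxx.
by move: i; apply: forall_ord3.
Qed.

Lemma rep_inj P P' (c : F) : (forall i, rep P i = c * rep P' i) -> P = P'.
Proof.
move=> H; move: (H i0) (H i1) (H i2).
case: P {H} => [[x y]|[x|[]]]; case: P' => [[x' y']|[x'|[]]]; rewrite /rep /vec3 /= ?mulr1 ?mulr0.
- by move=> <-; rewrite !mul1r => -> ->.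
- by move/eqP; rewrite oner_eq0.
- by move/eqP; rewrite oner_eq0.
- by move=> <-; rewrite mul0r => /eqP; rewrite oner_eq0.
- by move=> _ <-; rewrite mul1r => ->.
- by move=> _ /eqP; rewrite oner_eq0.
- by move=> <- _; rewrite mul0r => /eqP; rewrite oner_eq0.
- by move=> _ <-; rewrite mul0r => /eqP; rewrite oner_eq0.
- by [].
Qed.

Definition incident P L : bool := dot (rep L) (rep P) == 0.

Lemma incident_sym P L : incident P L = incident L P.
Proof. by rewrite /incident /dot !sum_ord3 !(mulrC (rep L _)). Qed.

Lemma card_affine_eq (c a : F) :
  (\sum_(b : F) (c + a * b == 0)%R = if a == 0%R then q * (c == 0)%R else 1)%N.
Proof.
case: eqVneq => [->|na].
  under eq_bigr do rewrite mul0r addr0.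
  by rewrite sum_nat_const.
rewrite (bigD1 (- c / a)) //= mulrCA divff // mulr1 subrr eqxx big1 // => b nb.
apply/eqP; rewrite eqb0; apply: contra nb => /eqP e; apply/eqP.
by apply: (mulfI na); rewrite mulrCA divff // mulr1; apply/eqP; rewrite -addr_eq0 addrC e.
Qed.

Lemma card_incident L : #|[set P | incident P L]| = q.+1.
Proof.
rewrite -sum1_card big_mkcond /=.
have -> : (\sum_P (if P \in [set P | incident P L] then 1 else 0) =
   \sum_(x : F) \sum_(y : F) (rep L i0 + rep L i1 * x + rep L i2 * y == 0)%R +
   (\sum_(x : F) (rep L i1 + rep L i2 * x == 0)%R + (rep L i2 == 0)%R))%N.
  rewrite big_sumType big_sumType /= [in RHS]pair_bigA /=; congr (_ + (_ + _))%N.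
  - by apply: eq_bigr => -[x y] _; rewrite inE /incident /dot sum_ord3 /rep /vec3 /= mulr1; case: ifP.
  - by apply: eq_bigr => x _; rewrite inE /incident /dot sum_ord3 /rep /vec3 /= mulr0 mulr1 add0r; case: ifP.
  - by rewrite (bigD1 tt) //= big1 ?addn0 => [|[] //];
    rewrite inE /incident /dot sum_ord3 /rep /vec3 /= !mulr0 mulr1 !add0r; case: ifP.
under eq_bigr do rewrite card_affine_eq.
rewrite card_affine_eq; have [e2|n2] := eqVneq (rep L i2) 0; last first.
  by rewrite sum_nat_const muln1 addn0 addn1 cardE -cardE.
rewrite -big_distrr /= card_affine_eq; have [e1|n1] := eqVneq (rep L i1) 0; last first.
  by rewrite muln1 muln0 add0n addn1.
have n0 : rep L i0 != 0.
  have [i] := rep_neq0 L; apply: contraNneq => e0.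
  by move: i; apply: forall_ord3; rewrite ?e0 ?e1 ?e2.
by rewrite (negbTE n0) !muln0 add0n muln1 addn1.
Qed.

Lemma card_incident_lines P : #|[set L | incident P L]| = q.+1.
Proof. by rewrite -(card_incident P); apply: eq_card => L; rewrite !inE incident_sym. Qed.

Lemma exists_other_line P L : exists2 L', L' != L & incident P L'.
Proof.
have : (1 < #|[set L' | incident P L']|)%N.
  by rewrite card_incident_lines ltnS; apply: ltnW; apply: finNzRing_gt1.
case/card_gt1P => L1 [L2 [h1 h2 n12]]; rewrite !inE in h1 h2.
have [e|ne] := eqVneq L1 L; last by exists L1.
by exists L2 => //; rewrite -e eq_sym.
Qed.

(** The coordinates of distinct points have a nonzero 2 x 2 minor, at indices i and j say. The form
    P'_j X_i - P'_i X_j then vanishes at P' and not at P. *)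
Lemma exists_separating_line P P' : P != P' -> exists2 L, incident P' L & ~~ incident P L.
Proof.
move=> nPP'.
have [i [j nij]] : exists i j, rep P' j * rep P i - rep P' i * rep P j != 0.
  apply: contrapT => H; case/eqP: nPP'.
  have e i j : rep P' j * rep P i = rep P' i * rep P j.
    by apply/eqP; rewrite -subr_eq0; apply: contrapT => /negP n; apply: H; exists i, j.
  by apply: (@rep_inj _ _ (rep P (pivot P'))) => i; rewrite -[LHS]mul1r -(rep_pivot P') e mulrC.
have nd : i != j by apply: contraNneq nij => ->; rewrite subrr.
pose b (k : 'I_3) := rep P' j * (k == i)%:R - rep P' i * (k == j)%:R.
have db v : dot b v = rep P' j * v i - rep P' i * v j.
  rewrite /dot; under eq_bigr do rewrite mulrBl -!mulrA.
  rewrite sumrB -!mulr_sumr; congr (_ * _ - _ * _).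
    by rewrite (bigD1 i) //= eqxx mul1r big1 ?addr0 // => k /negbTE ->; rewrite mul0r.
  by rewrite (bigD1 j) //= eqxx mul1r big1 ?addr0 // => k /negbTE ->; rewrite mul0r.
have [|L [c [nc bL]]] := @rep_normalise b.
  apply: contrapT => H; move: nij; rewrite -db /dot big1 ?eqxx // => k _.
  have -> : b k = 0 by apply/eqP; apply: contrapT => /negP n; apply: H; exists k.
  by rewrite mul0r.
have dL v : dot b v = c * dot (rep L) v.
  by rewrite /dot mulr_sumr; apply: eq_bigr => k _; rewrite bL mulrA.
exists L.
  have := db (rep P'); rewrite dL [rep P' i * _]mulrC subrr => /eqP.
  by rewrite mulf_eq0 (negbTE nc).
by move: nij; rewrite -db dL mulf_eq0 (negbTE nc).
Qed.

Lemma basis_incident L : dot (rep L) (basis1 L) = 0 /\ dot (rep L) (basis2 L) = 0.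
Proof.
by case: L => [[x y]|[x|[]]]; rewrite /dot !sum_ord3 /rep /basis1 /basis2 /vec3 /=; split; ring.
Qed.

Lemma basis_coord L :
  [/\ basis1 L (coord1 L) = 1, basis1 L (coord2 L) = 0,
      basis2 L (coord1 L) = 0 & basis2 L (coord2 L) = 1].
Proof. by case: L => [[x y]|[x|[]]]. Qed.

Lemma line_param (K : fieldType) (phi : {rmorphism F -> K}) L (v : 'I_3 -> K) :
  \sum_i phi (rep L i) * v i = 0 ->
  forall i, v i = v (coord1 L) * phi (basis1 L i) + v (coord2 L) * phi (basis2 L i).
Proof.
rewrite sum_ord3; case: L => [[x y]|[x|[]]];
  rewrite /rep /basis1 /basis2 /coord1 /coord2 /vec3 /= ?rmorph0 ?rmorph1 => H;
  apply: forall_ord3; rewrite /= ?rmorphN ?rmorph0 ?rmorph1 ?mulr0 ?mulr1 ?addr0 ?add0r //.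
- by apply: (addIr (phi x * v i1 + phi y * v i2)); rewrite addrA -[v i0]mul1r H; ring.
- by move: H; rewrite mul0r mul1r add0r mulrN [v i2 * _]mulrC => /eqP; rewrite addr_eq0 => /eqP.
- by move: H; rewrite !mul0r !add0r mul1r.
Qed.

(** A form that vanishes on a basis of L is a multiple of its equation; the factor is read off at
    the pivot, where [rep L] is 1. *)
Lemma normal_prop L (G : 'I_3 -> F) : dot G (basis1 L) = 0 -> dot G (basis2 L) = 0 ->
  forall i, G i = G (pivot L) * rep L i.
Proof.
rewrite /dot !sum_ord3; case: L => [[x y]|[x|[]]];
  rewrite /rep /basis1 /basis2 /pivot /vec3 /= => H1 H2;
  apply: forall_ord3 => /=; rewrite ?mulr1 ?mulr0 //.
- by move: H1; rewrite mulr0 addr0 mulr1 mulrN => /eqP; rewrite addrC subr_eq0 => /eqP.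
- by move: H2; rewrite mulr0 addr0 mulr1 mulrN => /eqP; rewrite addrC subr_eq0 => /eqP.
- by move: H1; rewrite !mulr0 !addr0 mulr1.
- by move: H2; rewrite mulr0 add0r mulr1 mulrN => /eqP; rewrite addrC subr_eq0 => /eqP.
- by move: H1; rewrite !mulr0 !addr0 mulr1.
- by move: H2; rewrite !mulr0 add0r addr0 mulr1.
Qed.

(** As [rep P] is 1 at the pivot, the value at P recovers the pivot coefficient of a form from the
    other two. *)
Lemma dot_coord_inj P (a b : 'I_3 -> F) : dot a (rep P) = dot b (rep P) ->
  a (coord1 P) = b (coord1 P) -> a (coord2 P) = b (coord2 P) -> a =1 b.
Proof.
rewrite /dot !sum_ord3; case: P => [[x y]|[x|[]]];
  rewrite /rep /coord1 /coord2 /vec3 /= => + e1 e2; rewrite ?e1 ?e2 ?mulr1 ?mulr0 ?add0r ?addr0.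
- by move=> /addIr/addIr e; apply: forall_ord3.
- by move=> /addIr e; apply: forall_ord3.
- by move=> e; apply: forall_ord3.
Qed.

End Plane.

(** * Lines that are tangent at no rational point *)

Section Separability.
Variable F : finFieldType.
Implicit Types (u p : {poly F}).

Lemma irreducible_factor u : (1 < size u)%N -> exists2 d, irreducible_poly d & d %| u.
Proof.
move: {2}(size u) (leqnn (size u)) => n; elim: n u => [|n IH] u; first by rewrite leqn0 => /eqP ->.
move=> le_u u1; have [iu|nu] := pselect (irreducible_poly u); first by exists u.
have [d [sd du ndu]] : exists d : {poly F}, [/\ size d != 1, d %| u & ~~ (d %= u)].
  apply: contrapT => H; apply: nu; split => // d sd du; apply: contrapT => /negP ndu.
  by apply: H; exists d.
have unz : u != 0 by rewrite -size_poly_gt0 ltnW.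
have dnz : d != 0 by apply: contraTneq du => ->; rewrite dvd0p.
have lt_d : (size d < size u)%N by rewrite ltn_neqAle dvdp_size_eqp // ndu dvdp_leq.
have [||e ie de] := IH d; first by rewrite -ltnS (leq_trans lt_d).
  by rewrite ltn_neqAle eq_sym sd size_poly_gt0.
by exists e => //; apply: dvdp_trans du.
Qed.

(* Finite fields are perfect: a polynomial with vanishing derivative is a
   p-th power, the coefficients being p-th powers by injectivity of Frobenius. *)
Lemma deriv0_square u : (1 < size u)%N -> u^`() = 0 ->
  exists2 w : {poly F}, (1 < size w)%N & w ^+ 2 %| u.
Proof.
move=> su du; have [p prp chp] := finPcharP F.
have chP : p \in [pchar {poly F}] by rewrite pchar_poly.
pose rt (c : F) := invF (fmorph_inj (pFrobenius_aut chp)) c.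
have rtK c : rt c ^+ p = c by rewrite -(pFrobenius_autE chp) /rt f_invF.
pose w := \sum_(i < size u) rt u`_(i * p) *: 'X^i : {poly F}.
have uE : u = w ^+ p.
  rewrite -(pFrobenius_autE chP) /w rmorph_sum /=; apply/polyP => k.
  rewrite coef_sum.
  under eq_bigr do rewrite pFrobenius_autE exprZn rtK -exprM coefZ coefXn.
  have [/dvdnP [j ->]|npk] := boolP (p %| k)%N; last first.
    rewrite big1 => [|i _]; last by case: eqP => [e|_]; [rewrite e dvdn_mull in npk|rewrite mulr0].
    case: k npk => [|k] npk; first by rewrite dvdn0 in npk.
    have := congr1 (fun a : {poly F} => a`_k) du; rewrite coef_deriv coef0 => /eqP.
    rewrite -mulr_natr mulf_eq0 => /orP [/eqP //|].
    by rewrite -(dvdn_pcharf chp) (negbTE npk).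
  have p0 := prime_gt0 prp.
  have [lt_j|le_j] := ltnP j (size u).
    rewrite (bigD1 (Ordinal lt_j)) //= eqxx mulr1 big1 ?addr0 // => i.
    rewrite -val_eqE /= => ni; rewrite eqn_pmul2r // eq_sym (negbTE ni) mulr0 //.
  rewrite nth_default; last by apply: leq_trans le_j _; rewrite leq_pmulr.
  rewrite big1 // => i _; rewrite eqn_pmul2r // gtn_eqF ?mulr0 //.
  exact: leq_trans (ltn_ord i) le_j.
exists w; last by rewrite [X in _ %| X]uE dvdp_exp2l // prime_gt1.
rewrite ltnNge; apply/negP => sw; move: su; rewrite uE (size1_polyC sw) -polyC_exp.
by rewrite ltnNge size_polyC_leq1.
Qed.

(** Over a finite field a nonconstant factor with zero derivative would itself contain a square, so
    being square-free suffices. *)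
Lemma squarefree_separable p : p != 0 -> (forall u, irreducible_poly u -> ~~ (u ^+ 2 %| p)) ->
  separable_poly p.
Proof.
move=> pnz sq.
have sq' u : (1 < size u)%N -> ~~ (u ^+ 2 %| p).
  move=> /irreducible_factor [d id du]; apply: contra (sq d id).
  exact/dvdp_trans/dvdp_exp2r.
apply/separable_polyP; split.
  apply/poly_square_freeP => u su; have [->|unz] := eqVneq u 0.
    by rewrite expr0n /= dvd0p.
  by apply: sq'; rewrite ltn_neqAle eq_sym su size_poly_gt0.
move=> u up su; apply/eqP => /(deriv0_square su) [w sw wu].
by have := sq' w sw; rewrite (dvdp_trans wu up).
Qed.

End Separability.

(** * Tangency at rational points and transversal lines *)

Section Curves.
Variable F : finFieldType.
Local Notation q := #|F|.
Implicit Types (f g : {mpoly F[3]}) (P L : plane F).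

Definition nonsingular_at f P := (f.@[rep P] != 0) || [exists i, (f^`M(i)).@[rep P] != 0].

(** The scalar c may be 0: at a singular point of the curve every line through P counts as
    tangent. *)
Definition tangent_at f P L :=
  [&& incident P L, f.@[rep P] == 0 & [exists c, [forall i, (f^`M(i)).@[rep P] == c * rep L i]]].

(** Vanishing to second order at P. Adding such a g changes neither nonsingularity nor tangency at
    P. *)
Definition null_jet g P := g.@[rep P] = 0 /\ forall i, (g^`M(i)).@[rep P] = 0.

Lemma null_jetD g h P : null_jet g P -> null_jet h P -> null_jet (g + h) P.
Proof.
by case=> g0 dg0 [h0 dh0]; split => [|i]; rewrite ?mderivD mevalD ?g0 ?h0 ?dg0 ?dh0 addr0.
Qed.

Lemma null_jet_sum (I : finType) (A : pred I) (G : I -> {mpoly F[3]}) P :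
  (forall i, A i -> null_jet (G i) P) -> null_jet (\sum_(i | A i) G i) P.
Proof.
move=> H; elim/big_rec: _ => [|i g Ai ng]; last by apply: null_jetD => //; apply: H.
by split => [|i]; rewrite ?mderiv0 meval0.
Qed.

Lemma null_jetMr g h P : null_jet g P -> null_jet (g * h) P.
Proof.
by case=> g0 dg0; split => [|i]; rewrite ?mderivM ?mevalD !mevalM g0 ?dg0 !mul0r ?addr0.
Qed.

Lemma null_jet_sqr g P : g.@[rep P] = 0 -> null_jet (g ^+ 2) P.
Proof. by move=> g0; split => [|i]; rewrite expr2 ?mderivM ?mevalD !mevalM g0 ?mulr0 ?mul0r ?addr0. Qed.

Lemma nonsingular_at_add f g P : null_jet g P -> nonsingular_at (f + g) P = nonsingular_at f P.
Proof.
case=> g0 dg0; rewrite /nonsingular_at mevalD g0 addr0; congr (_ || _).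
by apply: eq_existsb => i; rewrite mderivD mevalD dg0 addr0.
Qed.

Lemma tangent_at_add f g P L : null_jet g P -> tangent_at (f + g) P L = tangent_at f P L.
Proof.
case=> g0 dg0; rewrite /tangent_at mevalD g0 addr0; congr [&& _, _ & _].
by apply: eq_existsb => c; apply: eq_forallb => i; rewrite mderivD mevalD dg0 addr0.
Qed.

Lemma smooth_nonsingular f P : smooth_curve f -> nonsingular_at f P.
Proof.
move=> sm; apply: contrapT => /negP; rewrite negb_or negbK negb_exists => /andP [/eqP f0 /forallP df0].
apply: sm; exists (fun i => iota F (rep P i)); split.
- by have [i ni] := rep_neq0 P; exists i; rewrite fmorph_eq0.
- by rewrite /on_curve meval_map_mpoly f0 rmorph0.
- by move=> i; have := df0 i; rewrite negbK meval_map_mpoly => /eqP ->; rewrite rmorph0.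
Qed.

(** The gradient at v kills a basis of L, hence is a multiple of its equation; homogeneity carries
    this to the normalised representative of v. *)
Lemma tangent_of_vector d f L (v : 'I_3 -> F) : f \is d.-homog ->
  (exists i, v i != 0) -> dot (rep L) v = 0 -> f.@[v] = 0 ->
  dot (fun i => (f^`M(i)).@[v]) (basis1 L) = 0 ->
  dot (fun i => (f^`M(i)).@[v]) (basis2 L) = 0 -> exists P, tangent_at f P L.
Proof.
move=> hf vnz Lv fv G1 G2; have [P [c [nc vE]]] := rep_normalise vnz.
have vE' : v = (fun i => c * rep P i) by apply/funext.
have ncd : c ^+ d != 0 by rewrite expf_neq0.
exists P; apply/and3P; split.
- move: Lv; rewrite /incident /dot; under eq_bigr do rewrite vE mulrCA.
  by rewrite -mulr_sumr => /eqP; rewrite mulf_eq0 (negbTE nc).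
- by move: fv; rewrite vE' (dhomog_scale _ _ hf) => /eqP; rewrite mulf_eq0 (negbTE ncd).
have /= H := normal_prop G1 G2.
(* The scalar comes from the scaling of derivatives: c times the gradient at v is c^d times the
   gradient at P. *)
apply/existsP; exists (c * (f^`M(pivot L)).@[v] / c ^+ d); apply/forallP => i; apply/eqP.
apply: (mulfI ncd); rewrite -(dhomog_deriv_scale _ _ _ hf) -vE'.
have /= -> := H i; rewrite -[_ / _ * _]mulrA mulrCA mulrA.
by move: (_ ^+ d) ncd (meval _ _) (rep L i) => a na b r; field.
Qed.

Definition line_restr L f := restr (basis1 L) (basis2 L) f.

(** At a double root t, both f and its derivative along [basis2] vanish at v = basis1 + t basis2.
    Euler's identity adds the direction v, and these two directions span L. *)
Lemma line_restr_no_linear_square d f L (t : F) : f \is d.-homog ->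
  ('X - t%:P) ^+ 2 %| line_restr L f -> exists P, tangent_at f P L.
Proof.
move=> hf /dvdpP [r e].
pose v i := basis1 L i + t * basis2 L i.
have fv : f.@[v] = 0.
  rewrite -restr_horner -[restr _ _ _]/(line_restr L f) e hornerM horner_exp hornerXsubC.
  by rewrite subrr expr0n mulr0.
have G2 : dot (fun i => (f^`M(i)).@[v]) (basis2 L) = 0.
  have : ((line_restr L f)^`()).[t] = 0.
    by rewrite e expr2 !derivM !(hornerXsubC, hornerM, hornerD) subrr !(mulr0, mul0r, addr0).
  rewrite /line_restr (restr_deriv _ _ hf) horner_sum /dot => H; rewrite -[RHS]H.
  by apply: eq_bigr => i _; rewrite hornerZ restr_horner mulrC.
have [b11 b12 b21 b22] := basis_coord L.
apply: (@tangent_of_vector d f L v) => //.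
- by exists (coord1 L); rewrite /v b11 b21 mulr0 addr0 oner_neq0.
- have [h1 h2] := basis_incident L; rewrite /dot /v; under eq_bigr do rewrite mulrDr mulrCA.
  by rewrite big_split /= -mulr_sumr -![\sum_i _]/(dot _ _) h1 h2 mulr0 addr0.
have := euler v hf; rewrite fv mulr0 => E.
rewrite -[RHS]E -[LHS]addr0 -[X in _ + X = _](mulr0 t) -[X in _ + t * X]G2 /dot mulr_sumr -big_split /=.
by apply: eq_bigr => i _; rewrite /v; ring.
Qed.

Lemma coef0_restr (u w : 'I_3 -> F) f : (restr u w f)`_0 = f.@[u].
Proof.
rewrite -horner_coef0 restr_horner; congr (meval _ _).
by apply/funext => i; rewrite mul0r addr0.
Qed.

Lemma coef1_restr d (u w : 'I_3 -> F) f : f \is d.-homog ->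
  (restr u w f)`_1 = dot (fun i => (f^`M(i)).@[u]) w.
Proof.
move=> hf; have := coef_deriv (restr u w f) 0; rewrite mulr1n => <-.
rewrite (restr_deriv _ _ hf) coef_sum /dot; apply: eq_bigr => i _.
by rewrite coefZ coef0_restr mulrC.
Qed.

(** The two top coefficients of the restriction are the value of f at [basis2] and its derivative
    there along [basis1]. If both vanished, L would be tangent at [basis2], so the degree drops by
    at most 1. *)
Lemma size_line_restr d f L : f \is d.-homog -> (0 < d)%N -> (forall P, ~~ tangent_at f P L) ->
  size (line_restr L f) = (if f.@[basis2 L] == 0 then d else d.+1).
Proof.
move=> hf d0 nt; have le_d := size_restr (basis1 L) (basis2 L) hf.
have top : (line_restr L f)`_d = f.@[basis2 L].
  by rewrite /line_restr (restr_rev _ _ hf) // subnn coef0_restr.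
have sub : (line_restr L f)`_d.-1 = dot (fun i => (f^`M(i)).@[basis2 L]) (basis1 L).
  rewrite /line_restr (restr_rev _ _ hf) ?leq_pred // -(coef1_restr _ _ hf).
  by congr (_`_ _); case: d d0 {hf nt le_d top} => // d _; rewrite subSnn.
case: ifPn => [/eqP f0|nf0]; apply/eqP; rewrite eqn_leq; last first.
  rewrite le_d /= ltnNge; apply/negP => le_s; case/eqP: nf0.
  by rewrite -top nth_default.
apply/andP; split.
  apply/leq_sizeP => j; rewrite leq_eqVlt => /orP [/eqP <-|lt_dj]; first by rewrite top.
  by rewrite nth_default // (leq_trans le_d).
rewrite leqNgt; apply/negP => lt_s.
have sub0 : (line_restr L f)`_d.-1 = 0 by rewrite nth_default // -ltnS prednK.
have [b11 b12 b21 b22] := basis_coord L.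
have [||||| P tP] := @tangent_of_vector d f L (basis2 L) hf.
- by exists (coord2 L); rewrite b22 oner_neq0.
- by case: (basis_incident L).
- exact: f0.
- by rewrite -sub.
- have := euler (basis2 L) hf; rewrite f0 mulr0 => E.
  by rewrite -[RHS]E /dot; apply: eq_bigr => i _; rewrite mulrC.
by have := nt P; rewrite tP.
Qed.

(** Absence of tangents excludes squares of linear factors, so the restriction is separable. Its
    roots, together with the point at infinity when the degree is d - 1, are d distinct intersection
    points. *)
Lemma no_tangent_meets_in_distinct d f L : f \is d.-homog -> (0 < d)%N ->
  (forall P, ~~ tangent_at f P L) ->
  (forall u, irreducible_poly u -> (2 < size u)%N -> ~~ (u ^+ 2 %| line_restr L f)) ->
  meets_in_distinct f d (rep L).
Proof.
move=> hf d0 nt sq; set g := line_restr L f.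
have sizeg := size_line_restr hf d0 nt.
have lin t : ~~ (('X - t%:P) ^+ 2 %| g).
  apply/negP => /(line_restr_no_linear_square hf) [P tP].
  by have := nt P; rewrite tP.
have gnz : g != 0 by apply: contraNneq (lin 0) => ->; rewrite dvdp0.
have sep : separable_poly g.
  apply: squarefree_separable => // u iu; have [su|] := ltnP 2 (size u); first exact: sq.
  move=> su; have su2 : size u = 2.
    by apply/eqP; rewrite eqn_leq su; case: iu.
  have [t rt] := poly2_root su2; apply: contra (lin t) => du.
  apply: dvdp_trans du; apply: dvdp_exp2r; by rewrite dvdp_XsubCl.
have [rs grs] := closed_field_poly_normal (map_poly (iota F) g).
have lgnz : lead_coef (map_poly (iota F) g) != 0 by rewrite lead_coef_eq0 map_poly_eq0.
have sep' : separable_poly (map_poly (iota F) g) by rewrite separable_map.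
have urs : uniq rs.
  move: sep'; rewrite {1}grs -separable_prod_XsubC.
  by rewrite (eqp_separable (eqp_scale _ lgnz)).
have srs : size rs = (size g).-1.
  by rewrite -(size_map_poly (iota F) g) grs size_scale // size_prod_XsubC.
have rootE t : (t \in rs) =
    ((map_mpoly (iota F) f).@[fun i => iota F (basis1 L i) + t * iota F (basis2 L i)] == 0).
  rewrite -horner_restr -/(line_restr L f) -/g -[RHS]/(root _ _) grs.
  by rewrite rootZ // root_prod_XsubC.
pose pt (t : Fbar F) i := iota F (basis1 L i) + t * iota F (basis2 L i).
pose inf i := iota F (basis2 L i).
have [b11 b12 b21 b22] := basis_coord L.
have ptc t : pt t (coord1 L) = 1 by rewrite /pt b11 b21 rmorph1 rmorph0 mulr0 addr0.
have ptc2 t : pt t (coord2 L) = t by rewrite /pt b12 b22 rmorph1 rmorph0 mulr1 add0r.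
have infc : inf (coord1 L) = 0 by rewrite /inf b21 rmorph0.
have infc2 : inf (coord2 L) = 1 by rewrite /inf b22 rmorph1.
have iota_dot v : \sum_i iota F (rep L i) * iota F (v i) = iota F (dot (rep L) v).
  by rewrite rmorph_sum; apply: eq_bigr => i _; rewrite rmorphM.
have [in1 in2] := basis_incident L.
have on_inf : on_line (rep L) inf by rewrite /on_line /inf iota_dot in2 rmorph0.
have on_pt t : on_line (rep L) (pt t).
  rewrite /on_line /pt; under eq_bigr do rewrite mulrDr mulrCA.
  by rewrite big_split /= -mulr_sumr !iota_dot in1 in2 rmorph0 mulr0 addr0.
have cinf : ((map_mpoly (iota F) f).@[inf] == 0) = (f.@[basis2 L] == 0).
  by rewrite meval_map_mpoly fmorph_eq0.
have szrs : size rs = (if f.@[basis2 L] == 0 then d.-1 else d) by rewrite srs sizeg; case: ifP.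
have hmap c v : (map_mpoly (iota F) f).@[fun i => c * v i] = c ^+ d * (map_mpoly (iota F) f).@[v].
  apply: dhomog_scale; apply/dhomogP => m; rewrite mcoeff_msupp mcoeff_map_mpoly => nm.
  by apply: (dhomog_mf hf); rewrite mcoeff_msupp -(fmorph_eq0 (iota F)).
(* The roots come first; the index d - 1 is left for the point at infinity exactly when f vanishes
   at [basis2]. *)
exists (fun k : 'I_d => if (k < size rs)%N then pt (nth 0 rs k) else inf); split.
- move=> k; case: ifPn => [lt_k|ge_k]; split.
  + by exists (coord1 L); rewrite ptc oner_neq0.
  + exact: on_pt.
  + by apply/eqP; rewrite -rootE mem_nth.
  + by exists (coord2 L); rewrite infc2 oner_neq0.
  + exact: on_inf.
  + apply/eqP; rewrite cinf; apply: contraNT ge_k; rewrite szrs => /negbTE ->.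
    exact: ltn_ord.
- move=> k l nkl; case: ifPn => lk; case: ifPn => ll [c cnz H].
  + have := H (coord1 L); have := H (coord2 L); rewrite !ptc !ptc2 mulr1 => e1 e2.
    move: e1; rewrite -e2 mul1r => /eqP; rewrite nth_uniq //.
    by move=> e; case/eqP: nkl; apply/val_inj/eqP.
  + by have := H (coord1 L); rewrite ptc infc mulr0 => /eqP; rewrite oner_eq0.
  + by have := H (coord1 L); rewrite ptc infc mulr1 => e; rewrite -e eqxx in cnz.
  + case/eqP: nkl; apply/val_inj; move: lk ll (ltn_ord k) (ltn_ord l) => /=.
    rewrite szrs; case: ifP => _; lia.
- move=> v [i0 vi0] vL vC.
  have vE := line_param (phi := iota F) vL.
  have [a0|anz] := eqVneq (v (coord1 L)) 0.
    have bnz : v (coord2 L) != 0.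
      by apply: contraNneq vi0 => b0; rewrite vE a0 b0 !mul0r addr0.
    have f0 : f.@[basis2 L] == 0.
      rewrite -cinf; have := vC; rewrite /on_curve.
      have -> : v = (fun i => v (coord2 L) * inf i) by apply/funext => i; rewrite vE a0 mul0r add0r.
      by rewrite hmap => /eqP; rewrite mulf_eq0 expf_eq0 (negbTE bnz) andbF.
    have lt_d : (d.-1 < d)%N by rewrite prednK.
    exists (Ordinal lt_d); exists (v (coord2 L)) => // i.
    by rewrite /= szrs f0 ltnn vE a0 mul0r add0r.
  pose t := v (coord2 L) / v (coord1 L).
  have vpt i : v i = v (coord1 L) * pt t i.
    by rewrite vE /pt mulrDr mulrA /t [_ * (_ / _)]mulrC divfK.
  have trs : t \in rs.
    rewrite rootE -/(pt t); have := vC; rewrite /on_curve.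
    rewrite (_ : v = (fun i => v (coord1 L) * pt t i)) ?hmap; last exact/funext.
    by move/eqP; rewrite mulf_eq0 expf_eq0 (negbTE anz) andbF.
  have lt_t : (index t rs < d)%N.
    apply: (@leq_trans (size rs)); first by rewrite index_mem.
    by rewrite szrs; case: ifP => // _; apply: leq_pred.
  exists (Ordinal lt_t); exists (v (coord1 L)) => // i.
  by rewrite /= index_mem trs nth_index.
Qed.

End Curves.

(** * Jets at a rational point *)

Section LocalCount.
Variables (F : finFieldType) (R : archiRealFieldType).
Local Notation q := #|F|.
Local Notation x := (q%:R^-1 : R).
Local Notation weight := (incidence_weight (@incident F) (x ^+ 2)).
Implicit Types (f K : {mpoly F[3]}) (P L : plane F).

Lemma bernoulli (p : R) n : 0 <= p <= 1 -> 1 - n%:R * p <= (1 - p) ^+ n.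
Proof.
move=> /andP [p0 p1]; elim: n => [|n IH]; first by rewrite mul0r subr0 expr0.
have p1' : 0 <= 1 - p by rewrite subr_ge0.
have := ler_wpM2l p1' IH; rewrite -exprS /=; apply: le_trans.
have := mulr_ge0 (mulr_ge0 (ler0n R n) p0) p0; rewrite -natr1; nra.
Qed.

Lemma invq2_bounds : 0 < x ^+ 2 < 1.
Proof.
have x0 : 0 < x by rewrite invr_gt0 q_gt0.
rewrite exprn_gt0 //= exprn_ilt1 ?invq_ge0 //.
by apply: le_lt_trans (invq_le_half F R) _; rewrite invf_lt1 ?ltr1n.
Qed.

Lemma invq2_01 : 0 <= x ^+ 2 <= 1.
Proof. by have /andP [h1 h2] := invq2_bounds; rewrite !ltW. Qed.

Lemma one_sub_invq_le : 1 - x <= (1 - x ^+ 2) ^+ q.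
Proof.
have := bernoulli q invq2_01; apply: le_trans.
by rewrite expr2 mulrA divff ?q_neq0 // mul1r.
Qed.

Lemma prod_weight_none P : \prod_L (1 - (x ^+ 2) *+ incident P L) = (1 - x ^+ 2) ^+ q.+1 :> R.
Proof.
rewrite -(card_incident_lines P) -prodr_const [RHS]big_mkcond; apply: eq_bigr => L _.
by rewrite inE; case: incident; rewrite ?mulr1n ?mulr0n ?subr0.
Qed.

Lemma weight_ge0 P L e : 0 <= weight P L e.
Proof.
have /andP [p0 p1] := invq2_01; rewrite /incidence_weight.
by case: e; case: incident; rewrite ?mulr1n ?mulr0n ?subr0 ?subr_ge0.
Qed.

Lemma perturb_val f K P (l : 'I_3 -> F) :
  (f + K * linf l).@[rep P] = f.@[rep P] + K.@[rep P] * dot l (rep P).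
Proof. by rewrite mevalD mevalM linfE. Qed.

Lemma perturb_grad f K P (l : 'I_3 -> F) i : ((f + K * linf l)^`M(i)).@[rep P] =
  (f^`M(i)).@[rep P] + (K^`M(i)).@[rep P] * dot l (rep P) + K.@[rep P] * l i.
Proof.
by rewrite mderivD mderivM linf_deriv !mevalD !mevalM linfE mevalC addrA.
Qed.

(** If f vanished at P its gradient would be nonzero, and by Euler's identity the line with these
    coefficients would pass through P and be tangent there. *)
Lemma not_tangent_val d f P : f \is d.-homog -> nonsingular_at f P ->
  (forall L, ~~ tangent_at f P L) -> f.@[rep P] != 0.
Proof.
move=> hf ns nt; apply/negP => /eqP f0; move: ns; rewrite /nonsingular_at f0 eqxx /=.
move=> /existsP /rep_normalise [L [c [nc gE]]]; have := nt L; case/and3P; split.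
- have := euler (rep P) hf; rewrite f0 mulr0 => E.
  have /eqP : c * dot (rep L) (rep P) = 0.
    by rewrite -[RHS]E /dot mulr_sumr; apply: eq_bigr => i _; rewrite gE; ring.
  by rewrite mulf_eq0 (negbTE nc).
- by rewrite f0.
- by apply/existsP; exists c; apply/forallP => i; rewrite gE.
Qed.

Lemma tangent_unique f P L L' : nonsingular_at f P ->
  tangent_at f P L -> tangent_at f P L' -> L = L'.
Proof.
move=> ns /and3P [_ /eqP f0 /existsP [c /forallP cE]] /and3P [_ _ /existsP [c' /forallP cE']].
move: ns; rewrite /nonsingular_at f0 eqxx /= => /existsP [i ni].
have nc : c != 0 by apply: contraNneq ni => c0; rewrite (eqP (cE i)) c0 mul0r.
apply: (@rep_inj _ _ _ (c^-1 * c')) => j; apply: (mulfI nc).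
by rewrite !mulrA divff // mul1r -(eqP (cE j)) (eqP (cE' j)).
Qed.

(** As K(P) is nonzero, l is determined by the first-order jet of f + K l at P. With no tangent the
    value at P is nonzero, leaving (q - 1) q^2 forms; with one tangent L0 the jet is a nonzero
    multiple of [rep L0], leaving q - 1. Both bounds fit the model through 1 - 1/q <= (1 - q^-2)^q;
    any other pattern is empty. *)
Lemma local_count d f K P (E : {ffun plane F -> bool}) :
  f \is d.-homog -> K \is d.-1.-homog -> (0 < d)%N -> K.@[rep P] != 0 ->
  #|[set l : {ffun 'I_3 -> F} | nonsingular_at (f + K * linf l) P &&
      [forall L, tangent_at (f + K * linf l) P L == E L]]|%:R
  <= (1 - x ^+ 2)^-1 * #|{ffun 'I_3 -> F}|%:R * \prod_L weight P L (E L).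
Proof.
move=> hf hK d0 nK; set S := [set l | _].
have q0 := q_gt0 F R; have x0 : 0 < x by rewrite invr_gt0.
have /andP [p0 p1] := invq2_bounds.
have hl (l : {ffun 'I_3 -> F}) : f + K * linf l \is d.-homog.
  by apply: rpredD => //; have := dhomogM hK (linf_homog l); rewrite addn1 prednK.
have cU : #|{ffun 'I_3 -> F}|%:R = q%:R ^+ 3 :> R by rewrite card_ffun card_ord natrX.
have pq : (1 - x ^+ 2) != 0 by rewrite subr_eq0 eq_sym lt_eqF.
have qx : q%:R * x = 1 by rewrite divff // gt_eqF.
have qm1 : (q - 1)%:R = q%:R * (1 - x) :> R.
  by rewrite natrB ?(ltnW (finNzRing_gt1 _)) // mulrBr qx mulr1.
have bern := one_sub_invq_le.
have [/existsP [L0 EL0]|/existsPn E0] := boolP [exists L, E L]; last first.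
  have -> : \prod_L weight P L (E L) = (1 - x ^+ 2) ^+ q.+1.
    by rewrite -(prod_weight_none P); apply: eq_bigr => L _; rewrite (negbTE (E0 L)).
  rewrite cU (exprS (1 - x ^+ 2)) mulrACA mulVf // mul1r.
  (* These are coordinates on the space of linear forms l, the first being shifted and scaled by
     K(P). *)
  pose h (l : {ffun 'I_3 -> F}) := ((f + K * linf l).@[rep P], (l (coord1 P), l (coord2 P))).
  have hinj : injective h.
    move=> l l' []; rewrite !perturb_val => /addrI/(mulfI nK) e e1 e2.
    by apply/ffunP; apply: dot_coord_inj e1 e2.
  have le_S : (#|S| <= (q - 1) * (q * q))%N.
    rewrite -(card_imset _ hinj); apply: (@leq_trans #|setX [set~ (0 : F)] [set: F * F]|); last first.
      by rewrite cardsX cardsC1 cardsT card_prod subn1.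
    apply/subset_leq_card/subsetP => _ /imsetP [l lS ->]; rewrite !inE andbT /=.
    move: lS; rewrite inE => /andP [ns /forallP tE].
    apply: (not_tangent_val (hl l) ns) => L; by rewrite (eqP (tE L)) E0.
  apply: (@le_trans _ _ ((q - 1) * (q * q))%:R); first by rewrite ler_nat.
  rewrite natrM qm1 natrM; have -> : q%:R * (1 - x) * (q%:R * q%:R) = q%:R ^+ 3 * (1 - x) by ring.
  by rewrite ler_wpM2l // exprn_ge0 // ltW.
(* An element of S shows that the pattern E is realised, hence that L0 passes through P and is its
   only line. *)
have [S0|/set0Pn [l lS]] := eqVneq S set0.
  rewrite S0 cards0; apply: mulr_ge0; last by apply: prodr_ge0 => L _; exact: weight_ge0.
  by apply: mulr_ge0 => //; rewrite invr_ge0 subr_ge0 ltW.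
have SE : forall l, l \in S ->
    nonsingular_at (f + K * linf l) P /\ forall L, tangent_at (f + K * linf l) P L = E L.
  by move=> l'; rewrite inE => /andP [ns /forallP tE]; split => // L; apply/eqP.
have [ns tE] := SE l lS.
have tL0 : tangent_at (f + K * linf l) P L0 by rewrite tE.
have EL L : E L = (L == L0).
  apply/idP/eqP => [EL|-> //]; apply: (tangent_unique ns) tL0; by rewrite tE.
have inc0 : incident P L0 by case/and3P: tL0.
have -> : \prod_L weight P L (E L) = x ^+ 2 * (1 - x ^+ 2) ^+ q.
  have inc1 : x ^+ 2 *+ incident P L0 = x ^+ 2 by rewrite inc0.
  rewrite (bigD1 L0) //= EL eqxx /incidence_weight /=; congr (_ * _); first exact: inc1.
  apply: (mulfI pq); rewrite -exprS -(prod_weight_none P) [RHS](bigD1 L0) //= inc1; congr (_ * _).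
  by apply: eq_bigr => L nL; rewrite EL (negbTE nL).
pose h (l : {ffun 'I_3 -> F}) := ((f + K * linf l)^`M(pivot L0)).@[rep P].
have gE l' : l' \in S -> forall i, ((f + K * linf l')^`M(i)).@[rep P] = h l' * rep L0 i.
  move=> /SE [_ /(_ L0)]; rewrite EL0 => /and3P [_ _ /existsP [c /forallP cE]] i.
  by rewrite (eqP (cE i)) /h (eqP (cE (pivot L0))) rep_pivot mulr1.
have vE l' : l' \in S -> (f + K * linf l').@[rep P] = 0.
  by move=> /SE [_ /(_ L0)]; rewrite EL0 => /and3P [_ /eqP].
have hinj : {in S &, injective h}.
  move=> l1 l2 S1 S2 e; apply/ffunP => i.
  have ed : dot l1 (rep P) = dot l2 (rep P).
    apply: (mulfI nK); apply: (@addrI _ f.@[rep P]); rewrite -!perturb_val !vE //.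
  have := gE _ S1 i; rewrite e -(gE _ S2) !perturb_grad ed.
  by move=> /addrI/(mulfI nK).
have le_S : (#|S| <= q - 1)%N.
  rewrite -(card_in_imset hinj) subn1 -(cardsC1 (0 : F)).
  apply/subset_leq_card/subsetP => _ /imsetP [l' lS' ->]; rewrite !inE.
  have [ns' _] := SE l' lS'; apply: contraL ns' => /eqP h0.
  rewrite /nonsingular_at vE // eqxx /= negb_exists; apply/forallP => i.
  by rewrite gE // h0 mul0r eqxx.
apply: (@le_trans _ _ (q - 1)%:R); first by rewrite ler_nat.
have -> : (1 - x ^+ 2)^-1 * #|{ffun 'I_3 -> F}|%:R * (x ^+ 2 * (1 - x ^+ 2) ^+ q) =
   q%:R * ((1 - x ^+ 2)^-1 * (1 - x ^+ 2) ^+ q).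
  have e : #|{ffun 'I_3 -> F}|%:R * x ^+ 2 = q%:R :> R.
    by rewrite cU exprVn (exprSr _ 2) mulrAC divff ?mul1r // expf_neq0 // gt_eqF.
  have aux (a u v w z : R) : u * v = z -> a * u * (v * w) = z * (a * w) by move=> <-; ring.
  exact: aux.
rewrite qm1 ler_pM2l //; apply: le_trans bern _.
rewrite ler_peMl ?exprn_ge0 ?subr_ge0 ?ltW // invf_gt1 ?subr_gt0 //; lra.
Qed.

End LocalCount.

(** * The randomisation and the density bound *)

Section Perturbation.
Variable F : finFieldType.
Local Notation q := #|F|.
Implicit Types (f g : {mpoly F[3]}) (P L : plane F).

(** This is M_L. Every rational point lies on a line other than L, so the square gives M_L a null
    jet at all of them, while M_L vanishes on every other line. *)
Definition other_lines L : {mpoly F[3]} := (\prod_(L' | L' != L) linf (rep L')) ^+ 2.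

Lemma other_lines_homog L : other_lines L \is ((q ^ 2 + q) * 2).-homog.
Proof.
apply: dhomogMn; have <- : #|[pred L' | L' != L]| = (q ^ 2 + q)%N.
  by have := cardC1 L; rewrite card_plane addn1 /= => <-.
by apply: prod_homog => L' _; apply: linf_homog.
Qed.

Lemma other_lines_null L P : null_jet (other_lines L) P.
Proof.
apply: null_jet_sqr; have [L' nL /eqP inc] := exists_other_line P L.
by rewrite (bigD1 L') //= mevalM linfE inc mul0r.
Qed.

Lemma line_restr_other L L' : L' != L -> line_restr L' (other_lines L) = 0.
Proof.
move=> nL; rewrite /line_restr /other_lines (bigD1 L') //= exprMn restrM expr2 restrM restr_linf.
by have [-> ->] := basis_incident L'; rewrite scale0r addr0 !mul0r.
Qed.

Lemma restr_line_neq0 L L' : L' != L -> line_restr L (linf (rep L')) != 0.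
Proof.
move=> nL; rewrite /line_restr restr_linf; apply: contra nL => /eqP e.
have c0 : dot (rep L') (basis1 L) = 0.
  by have := congr1 (fun u : {poly F} => u`_0) e; rewrite coefD coefC coefZ coefX mulr0 addr0 coef0.
have c1 : dot (rep L') (basis2 L) = 0.
  by have := congr1 (fun u : {poly F} => u`_1) e; rewrite coefD coefC coefZ coefX mulr1 add0r coef0.
exact/eqP/(rep_inj (normal_prop c0 c1)).
Qed.

Lemma line_restr_prod L (I : finType) (A : pred I) (G : I -> {mpoly F[3]}) :
  line_restr L (\prod_(i | A i) G i) = \prod_(i | A i) line_restr L (G i).
Proof. exact: rmorph_prod. Qed.

Lemma line_restr_own_neq0 L : line_restr L (other_lines L) != 0.
Proof.
rewrite /other_lines expr2 [line_restr _ _]restrM mulf_neq0 // [restr _ _ _]line_restr_prod;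
  by apply/prodf_neq0 => L' nL; apply: restr_line_neq0.
Qed.

(** Restricted to L, M_L is a product of nonzero polynomials of degree at most 1. *)
Lemma line_restr_own_coprime L u : irreducible_poly u -> (2 < size u)%N ->
  coprimep u (line_restr L (other_lines L)).
Proof.
move=> iu su; rewrite /other_lines expr2 [line_restr _ _]restrM.
suff cop : coprimep u (line_restr L (\prod_(L' | L' != L) linf (rep L'))) by rewrite coprimepMr cop.
rewrite line_restr_prod; elim/big_rec: _ => [|L' g nL cg]; first exact: coprimep1.
rewrite coprimepMr cg andbT irreducible_poly_coprime //; apply/negP => du.
have := dvdp_leq (restr_line_neq0 nL) du; rewrite leqNgt => /negP; apply.
exact: leq_ltn_trans (size_restr _ _ (linf_homog _)) su.
Qed.

(** The homogenisation, of degree k - 1, of a polynomial of degree less than k in the two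
    coordinates of L; restricting it to L gives that polynomial back. *)
Definition binary_form L k (h : 'rV[F]_k) : {mpoly F[3]} :=
  \sum_(i < k) (rVpoly h)`_i *: ('X_(coord1 L) ^+ (k.-1 - i) * 'X_(coord2 L) ^+ i).

Lemma binary_form_homog L k (h : 'rV[F]_k) : binary_form L h \is k.-1.-homog.
Proof.
apply: rpred_sum => i _; apply: rpredZ.
have le_i : (i <= k.-1)%N by rewrite -ltnS prednK // (leq_ltn_trans (leq0n i)).
have hX (j : 'I_3) n : 'X_j ^+ n \is [in F[3], n.-homog].
  by have := @dhomogMn 3 F mdeg 1 'X_j n; rewrite mul1n; apply; rewrite dhomogX /= mdeg1.
by have := dhomogM (hX (coord1 L) (k.-1 - i)%N) (hX (coord2 L) i); rewrite subnK.
Qed.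

Lemma line_restr_binary_form L k (h : 'rV[F]_k) : line_restr L (binary_form L h) = rVpoly h.
Proof.
have [b11 b12 b21 b22] := basis_coord L.
rewrite /line_restr /binary_form /restr raddf_sum /=.
rewrite [RHS](_ : _ = \poly_(i < k) (rVpoly h)`_i); last first.
  by apply/polyP => i; rewrite coef_poly; case: ltnP => // le_k; rewrite nth_default // (leq_trans (size_rVpoly h)).
rewrite poly_def; apply: eq_bigr => i _; rewrite mmapZ rmorphM !rmorphXn /= !mmapX !mmap1U.
by rewrite b11 b12 b21 b22 scale0r addr0 expr1n mul1r scale1r add0r mul_polyC.
Qed.

(** K_P is the squared product of all lines missing P, one of which passes through each other point.
    A power of the pivot coordinate, which is 1 at P, raises its degree to d - 1. *)
Lemma point_separator d P : (2 * (q ^ 2 + q + 1) < d)%N ->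
  exists K, [/\ K \is d.-1.-homog, K.@[rep P] != 0 & forall P', P' != P -> null_jet K P'].
Proof.
move=> lt_d; pose n := #|[pred L | ~~ incident P L]|.
have le_n : (n <= q ^ 2 + q + 1)%N by rewrite -card_plane max_card.
exists ((\prod_(L | ~~ incident P L) linf (rep L)) ^+ 2 * 'X_(pivot P) ^+ (d.-1 - n * 2)); split.
- have h1 : (\prod_(L | ~~ incident P L) linf (rep L)) ^+ 2 \is (n * 2).-homog.
    by apply: dhomogMn; apply: prod_homog => L _; apply: linf_homog.
  have h2 : 'X_(pivot P) ^+ (d.-1 - n * 2) \is [in F[3], (d.-1 - n * 2).-homog].
    by have := @dhomogMn 3 F mdeg 1 'X_(pivot P) (d.-1 - n * 2); rewrite mul1n; apply; rewrite dhomogX /= mdeg1.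
  by have := dhomogM h1 h2; rewrite subnKC //; lia.
- rewrite mevalM !rmorphXn /= mevalXU rep_pivot expr1n mulr1 expf_neq0 // rmorph_prod /=.
  by apply/prodf_neq0 => L nL; rewrite linfE.
move=> P' nP; apply/null_jetMr/null_jet_sqr.
have [|L inc ninc] := @exists_separating_line _ P P'; first by rewrite eq_sym.
by rewrite (bigD1 L) //= mevalM linfE (eqP inc) mul0r.
Qed.

Lemma poly_of_homog d (c : {ffun hmon d -> F}) : poly_of c \is d.-homog.
Proof.
apply: rpred_sum => m _; apply: rpredZ; rewrite dhomogX /=; exact: (valP m).
Qed.

Lemma poly_ofD d (c c' : {ffun hmon d -> F}) : poly_of (c + c') = poly_of c + poly_of c'.
Proof.
by rewrite /poly_of -big_split; apply: eq_bigr => m _; rewrite ffunE scalerDl.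
Qed.

Lemma poly_of_surj d g : g \is d.-homog -> exists c : {ffun hmon d -> F}, poly_of c = g.
Proof.
move=> hg; exists [ffun m => g@_(bmnm (val m))]; apply/mpolyP => m.
rewrite /poly_of raddf_sum /=.
under eq_bigr do rewrite ffunE mcoeffZ mcoeffX.
have [dm|ndm] := eqVneq (mdeg m) d; last first.
  rewrite (dhomog_nemf_coeff hg) // big1 // => m' _; case: eqP => [e|_]; last by rewrite mulr0.
  by case/eqP: ndm; rewrite -e; case: m' {e} => m' /= /eqP.
have lt_m : (mdeg m < d.+1)%N by rewrite dm.
have dm' : mdeg (BMultinom lt_m) == d by apply/eqP.
rewrite (bigD1 (exist _ (BMultinom lt_m) dm')) //= eqxx mulr1 big1 ?addr0 // => m' nm.
case: eqP => [e|_]; last by rewrite mulr0.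
by case/eqP: nm; apply/val_inj/val_inj.
Qed.

End Perturbation.

(** * Averaging over perturbations *)

Section Density.
Variables (F : finFieldType) (R : archiRealFieldType).
Local Notation q := #|F|.
Local Notation x := (q%:R^-1 : R).

(** Each translation by G y permutes the coefficient vectors, so the pairs (c, y) with c + G y in
    the set number #|A| #|Y|; for each c at most B values of y occur. *)
Lemma card_le_translates d (Y : finType) (G : Y -> {mpoly F[3]}) (B : R) :
  (forall y, G y \is d.-homog) ->
  (forall f, f \is d.-homog -> #|[set y | `[< in_calF (f + G y) d >]]|%:R <= B) ->
  #|[set c : {ffun hmon d -> F} | `[< in_calF (poly_of c) d >]]|%:R * #|Y|%:R <=
    #|{ffun hmon d -> F}|%:R * B.
Proof.
move=> hG hB; set A := [set c | _].
have /fin_all_exists [cG cGE] : forall y, exists c : {ffun hmon d -> F}, poly_of c = G y.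
  by move=> y; apply: poly_of_surj.
have trans y : #|A| = (\sum_(c : {ffun hmon d -> F}) ((c + cG y)%R \in A))%N.
  rewrite -sum1_card big_mkcond /= (reindex_inj (addIr (cG y))) /=.
  by apply: eq_bigr => c _; case: (_ \in A).
have -> : #|A|%:R * #|Y|%:R = (\sum_(y : Y) \sum_(c : {ffun hmon d -> F}) ((c + cG y)%R \in A))%N%:R :> R.
  under eq_bigr do rewrite -trans.
  by rewrite sum_nat_const mulnC natrM.
rewrite exchange_big /= natr_sum [leRHS]mulr_natl -sumr_const.
apply: ler_sum => c _; apply: le_trans (hB (poly_of c) (poly_of_homog c)).
rewrite ler_nat -sum1_card [X in (_ <= X)%N]big_mkcond /=; apply: leq_sum => y _.
by rewrite !inE poly_ofD cGE; case: `[< _ >].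
Qed.

(** The parameter r is the cutoff of the sieve: once d is large in terms of r, the error is a
    constant times q^-r. *)
Lemma mu_bound r : exists d0, forall d, (d0 <= d)%N ->
  ratr (mu F d) <= (1 - x ^+ 2) ^- (q ^ 2 + q + 1) *
    (x + x ^+ 2 - x ^+ 3 +
      3 * q%:R ^+ ((q ^ 2 + q) * 2) * x ^+ r * (1 - x ^+ 2) ^+ q.+1) ^+ (q ^ 2 + q + 1) :> R.
Proof.
pose n := ((q ^ 2 + q) * 2)%N.
have [k0 sieve] := square_sieve F R r n.
exists (k0 + n + n + 3)%N => d le_d.
(* A binary form of degree d - n has d - n + 1 coefficients, and its product with M_L has degree
   d. *)
pose k := (d - n).+1.
have d0 : (0 < d)%N by lia.
have kE : k.-1 = (d - n)%N by [].
have kn : (k + n = d.+1)%N by rewrite /k; lia.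
have /fin_all_exists [K hK] : forall P, exists K : {mpoly F[3]},
    [/\ K \is d.-1.-homog, K.@[rep P] != 0 & forall P', P' != P -> null_jet K P'].
  by move=> P; apply: point_separator; rewrite mulnC; move: le_d; rewrite /n; lia.
pose U : finType := {ffun 'I_3 -> F}.
pose H : finType := 'rV[F]_k.
pose Y : finType := ({ffun plane F -> U} * {ffun plane F -> H})%type.
pose G1 (l : {ffun plane F -> U}) := \sum_P K P * linf (l P).
pose G2 (h : {ffun plane F -> H}) := \sum_L other_lines L * binary_form L (h L).
pose G (y : Y) := G1 y.1 + G2 y.2.
have hKl P (l : U) : K P * linf l \is d.-homog.
  by have [hKP _ _] := hK P; have := dhomogM hKP (linf_homog l); rewrite addn1 prednK.
have hG1 l : G1 l \is d.-homog by apply: rpred_sum => P _; apply: hKl.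
have hG y : G y \is d.-homog.
  apply: rpredD => //; apply: rpred_sum => L _.
  have := dhomogM (other_lines_homog L) (binary_form_homog L (y.2 L)).
  by rewrite kE subnKC // -/n; lia.
(* The lower bound for the probability of avoiding large squares, with the error of the sieve
   subtracted. *)
pose s : R := (1 - x) * (1 - x ^+ 2) ^- q - 3 * q%:R ^+ n * x ^+ r.
have /andP [p0 p1] := invq2_bounds F R.
have pq : 0 < 1 - x ^+ 2 by rewrite subr_gt0.
have x0 := invq_ge0 F R.
pose bound : R := ((1 - x ^+ 2)^-1 * #|U|%:R * #|H|%:R) ^+ #|plane F| *
   \prod_(L : plane F) (1 - s * \prod_(P : plane F) (1 - (x ^+ 2) *+ incident P L)).
have le_S f : f \is d.-homog -> #|[set y | `[< in_calF (f + G y) d >]]|%:R <= bound.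
  move=> hf.
  (* Once the forms l_P are fixed, the restriction to L runs through a progression in h_L alone. *)
  pose bad (l : {ffun plane F -> U}) L :=
    square_bad k (line_restr L (f + G1 l)) (line_restr L (other_lines L)).
  (* At P every term other than K_P l_P has a null jet, so nonsingularity and tangency at P depend
     on l_P alone. *)
  have jet (y : Y) P : exists2 g, null_jet g P & f + G y = f + K P * linf (y.1 P) + g.
    exists (\sum_(P' | P' != P) K P' * linf (y.1 P') + G2 y.2); last first.
      by rewrite /G /G1 (bigD1 P) //= !addrA.
    apply: null_jetD.
      apply: null_jet_sum => P' nP; apply: null_jetMr.
      by have [_ _] := hK P'; apply; rewrite eq_sym.
    by apply: null_jet_sum => L _; apply/null_jetMr/other_lines_null.
  apply: (@incidence_bound R (plane F) (@incident F) (x ^+ 2) s U H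
    (fun P l => nonsingular_at (f + K P * linf l) P)
    (fun P l => tangent_at (f + K P * linf l) P) bad).
  - exact: invq2_01.
  - by rewrite invr_ge0 ltW.
  - rewrite lerBlDr; apply: ler_wpDr; first by rewrite !mulr_ge0 ?exprn_ge0 ?ler0n.
    by rewrite ler_pdivrMr ?exprn_gt0 // mul1r one_sub_invq_le.
  - move=> y; rewrite inE => /asboolP [_ _ _ sm _] P.
    by have [g ng e] := jet y P; rewrite -(nonsingular_at_add _ ng) -e smooth_nonsingular.
  - move=> y; rewrite inE => /asboolP [hfy _ _ _ tf] L.
    apply/orP; case: (boolP [exists P, tangent_at (f + K P * linf (y.1 P)) P L]) => [|nt]; [by left|right].
    apply: contrapT => nb; apply: (tf (rep L)); first exact: rep_neq0.
    apply: no_tangent_meets_in_distinct => // [P|u iu su].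
      have [g ng e] := jet y P; rewrite e tangent_at_add //.
      by move: nt; rewrite negb_exists => /forallP /(_ P).
    apply/negP => du; apply: nb; rewrite inE; apply/asboolP; exists u; split => //.
    suff <- : line_restr L (f + G y) =
      line_restr L (f + G1 y.1) + line_restr L (other_lines L) * rVpoly (y.2 L) by [].
    rewrite /G addrA [LHS]restrD; congr (_ + _).
    rewrite /G2 (bigD1 L) //= restrD restrM [X in _ * X]line_restr_binary_form.
    rewrite [X in _ + X](_ : _ = 0) ?addr0 //.
    rewrite /restr raddf_sum big1 // => L' nL; rewrite /= rmorphM /=.
    by rewrite -![mmap _ _ _]/(line_restr L _) line_restr_other ?mul0r // eq_sym.
  - move=> l L; rewrite card_rV natrX mulrC.
    have -> : 1 - s = 1 - (1 - x) * (1 - x ^+ 2) ^- q + 3 * q%:R ^+ n * x ^+ r by rewrite /s; ring.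
    apply: sieve.
    + by rewrite /k; lia.
    + exact: line_restr_own_neq0.
    + by move=> u; apply: line_restr_own_coprime.
    + exact: size_restr _ _ (other_lines_homog L).
    + by rewrite kn; apply: size_restr; apply: rpredD; [exact: hf | exact: hG1].
  - by move=> P E; apply: (@local_count _ _ d) => //; have [? ? ?] := hK P.
have q0 := q_gt0 F R.
have U0 : 0 < #|U|%:R :> R by rewrite card_ffun card_ord natrX exprn_gt0.
have H0 : 0 < #|H|%:R :> R by rewrite card_rV natrX exprn_gt0.
have YE : #|Y|%:R = (#|U|%:R * #|H|%:R) ^+ #|plane F| :> R.
  by rewrite card_prod !card_ffun natrM !natrX exprMn.
have Y0 : 0 < #|Y|%:R :> R by rewrite YE exprn_gt0 // mulr_gt0.
have V0 : 0 < #|{ffun hmon d -> F}|%:R :> R by rewrite card_ffun natrX exprn_gt0.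
have key := card_le_translates hG le_S.
have boundE : bound = #|Y|%:R * ((1 - x ^+ 2) ^- (q ^ 2 + q + 1) *
    (x + x ^+ 2 - x ^+ 3 + 3 * q%:R ^+ n * x ^+ r * (1 - x ^+ 2) ^+ q.+1) ^+ (q ^ 2 + q + 1)).
  have e : ((1 - x ^+ 2)^-1 * #|U|%:R * #|H|%:R) ^+ #|plane F| =
      #|Y|%:R * (1 - x ^+ 2) ^- (q ^ 2 + q + 1) :> R.
    by rewrite YE -mulrA exprMn mulrC exprVn -card_plane.
  rewrite /bound e -[LHS]mulrA; congr (_ * (_ * _)).
  rewrite -card_plane -prodr_const; apply: eq_bigr => L _.
  have -> : \prod_P (1 - x ^+ 2 *+ incident P L) = (1 - x ^+ 2) ^+ q.+1.
    by rewrite -(prod_weight_none R L); apply: eq_bigr => P _; rewrite incident_sym.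
  (* With p = x^2, the main part of s (1 - p)^(q+1) is (1 - x)(1 - x^2), and 1 minus this is x + x^2
     - x^3. *)
  rewrite /s (exprS (1 - x ^+ 2)); have := expf_neq0 q (lt0r_neq0 pq).
  move: ((1 - x ^+ 2) ^+ q) (3 * q%:R ^+ n * x ^+ r) => a b na.
  by move: x a na => t a na; field.
rewrite /mu fmorph_div /= !ratr_nat ler_pdivrMr // mulrC -(ler_pM2r Y0).
have aux (a b c : R) : a * (b * c) <= a * c * b by rewrite mulrA mulrAC.
by apply: le_trans key _; rewrite boundE; apply: aux.
Qed.

End Density.

End PlaneGeometry.

(* Passage to the upper density *)
From mathcomp Require Import all_classical all_reals all_analysis.
Import PlaneGeometry numFieldNormedType.Exports.

Lemma limn_esup_le_eventually (R : realType) (u : nat -> \bar R) (b : \bar R) d0 :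
  (forall d, (d0 <= d)%N -> (u d <= b)%E) -> (limn_esup u <= b)%E.
Proof.
move=> ub; apply: ge_ereal_inf.
exists (ereal_sup [set u d | d in [set d | (d0 <= d)%N]]%classic).
  by exists [set d | (d0 <= d)%N]%classic => //; exact: nbhs_infty_ge.
by apply: ge_ereal_sup => _ [d /= le_d <-]; exact: ub.
Qed.

(* q = #|F|; upper density = limsup_d mu_d, taken in the extended reals. *)
Theorem theorem5p1 (R : realType) (F : finFieldType) :
  let q : R := (#|F|)%:R in
  let N : nat := (#|F| ^ 2 + #|F| + 1)%N in
  (limn_esup (fun d : nat => ((ratr (mu F d) : R)%:E)) <=
   (((1 - q ^- 2) ^- N) * (q^-1 + q ^- 2 - q ^- 3) ^+ N)%:E)%E.
Proof.
cbv zeta; set q : R := #|F|%:R; set N := (#|F| ^ 2 + #|F| + 1)%N.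
pose e (r : nat) : R := 3 * q ^+ ((#|F| ^ 2 + #|F|) * 2) * q^-1 ^+ r * (1 - q^-1 ^+ 2) ^+ #|F|.+1.
have e0 : (e r @[r --> \oo] --> (0 : R))%classic.
  pose c : R := 3 * q ^+ ((#|F| ^ 2 + #|F|) * 2) * (1 - q^-1 ^+ 2) ^+ #|F|.+1.
  have -> : e = geometric c q^-1.
    by apply/funext => r; rewrite /geometric /= /e /c mulrAC.
  apply: cvg_geometric; rewrite ger0_norm ?invq_ge0 //.
  by apply: le_lt_trans (invq_le_half F R) _; rewrite invf_lt1 ?ltr1n.
(* The limsup in d is bounded for each fixed r; only afterwards does r tend to infinity, which
   removes the error e r. *)
apply: (@cvge_ge _ \oo%classic _ R
  (fun r => ((1 - q^-1 ^+ 2) ^- N * (q^-1 + q^-1 ^+ 2 - q^-1 ^+ 3 + e r) ^+ N)%:E)).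
  apply: nearW => r; have [d0 le_mu] := mu_bound F R r.
  by apply: (@limn_esup_le_eventually _ _ _ d0) => d /le_mu; rewrite lee_fin.
rewrite -!exprVn; apply: cvg_EFin; first exact: nearW.
apply: cvgM; first exact: cvg_cst.
have ae : (q^-1 + q^-1 ^+ 2 - q^-1 ^+ 3 + e r @[r --> \oo] --> q^-1 + q^-1 ^+ 2 - q^-1 ^+ 3)%classic.
  have := @cvgD R R nat \oo%classic _ _ _ _ _ (cvg_cst (q^-1 + q^-1 ^+ 2 - q^-1 ^+ 3)) e0.
  rewrite addr0; exact.
apply: (@cvg_comp _ _ _ _ (fun y : R => y ^+ N) _ _ _ ae); exact: exprn_continuous.
Qed.
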